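(* Let $\phi:\mathbb{R}^n\setminus\{0\}\to\mathbb{G}(k,E)$ be a homogeneous bundle whose restriction to $S^{n-1}$ is Hölder continuous with some exponent $>\tfrac12$, let $\mu\in M_\phi(\mathbb{R}^n,E)$ and let $A\subset\mathbb{R}^n$ be a Borel set. Then $$N(A)\subset\{u\in\mathbb{R}^n:\ \|u\|=1,\ \mu(A)\in\phi(u)\}.$$
   Context: $E=\mathbb{C}^m$; $\mathbb{G}(k,E)$ is the Grassmannian of $k$-dimensional subspaces of $E$ with a standard metric. A homogeneous bundle is a continuous $\phi:\mathbb{R}^n\setminus\{0\}\to\mathbb{G}(k,E)$ with $\phi(a\xi)=\phi(\xi)$ for $a>0$. $M_\phi(\mathbb{R}^n,E)$ is the set of finite $E$-valued Borel measures $\mu$ with $\hat\mu(\xi)\in\phi(\xi)$ for $\xi\ne0$ (coordinatewise Fourier transform $\hat\mu(\xi)=\int e^{-2\pi i\langle\xi,x\rangle}d\mu$). For $A\subset\mathbb{R}^n$, $N(A)=\{v\in\mathbb{R}^n:\|v\|=1,\ \lambda(p_v(A))=0\}$, where $p_v$ is the orthogonal projection onto $\mathrm{span}\{v\}$ and $\lambda$ is one-dimensional Lebesgue measure on that line. *)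

(* Defs.v *)
From HB Require Import structures.
From mathcomp Require Import all_boot all_order all_algebra.
From mathcomp Require Import complex.
From mathcomp Require Import all_classical all_reals all_analysis.
Set Implicit Arguments. Unset Strict Implicit. Unset Printing Implicit Defensive.
Import Order.TTheory GRing.Theory Num.Theory.
Import numFieldNormedType.Exports.
Local Open Scope classical_set_scope.
Local Open Scope ring_scope.

Notation Rn R n := (g_sigma_algebraType (@open 'rV[R]_n)).

Section Defs.
Variable R : realType.

Definition C := R[i].
Definition cR (x : R) : C := Complex x 0.
Definition iC : C := Complex 0 1.

Definition dotv n (u v : 'rV[R]_n) : R := \sum_(i < n) u 0 i * v 0 i.
Definition enorm n (v : 'rV[R]_n) : R := Num.sqrt (dotv v v).

(* A finite E-valued (E = C^m) Borel measure on R^n, given through the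
   Jordan decompositions of the real and imaginary parts of each coordinate:
   mu_j = (re_pos j - re_neg j) + i (im_pos j - im_neg j).
   Every finite C^m-valued Borel measure arises in this way. *)
Record cmeasure n m := CMeasure {
  re_pos : 'I_m -> {finite_measure set (Rn R n) -> \bar R};
  re_neg : 'I_m -> {finite_measure set (Rn R n) -> \bar R};
  im_pos : 'I_m -> {finite_measure set (Rn R n) -> \bar R};
  im_neg : 'I_m -> {finite_measure set (Rn R n) -> \bar R} }.

Definition cmeas_val n m (mu : cmeasure n m) (A : set (Rn R n)) : 'rV[C]_m :=
  \row_j (cR (fine (re_pos mu j A) - fine (re_neg mu j A)) +
          iC * cR (fine (im_pos mu j A) - fine (im_neg mu j A))).

Definition rint n (nu : {finite_measure set (Rn R n) -> \bar R}) (f : Rn R n -> R) : R :=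
  fine (\int[nu]_x (f x)%:E).

Definition cint n m (mu : cmeasure n m) (j : 'I_m) (f : Rn R n -> R) : C :=
  cR (rint (re_pos mu j) f - rint (re_neg mu j) f) +
  iC * cR (rint (im_pos mu j) f - rint (im_neg mu j) f).

Definition fourier n m (mu : cmeasure n m) (xi : 'rV[R]_n) : 'rV[C]_m :=
  \row_j (cint mu j (fun x : Rn R n => cos (2 * pi * dotv xi x)) -
          iC * cint mu j (fun x : Rn R n => sin (2 * pi * dotv xi x))).

(* Subspaces of E = C^m are represented by the row space of an m x m matrix.
   Orthogonal projection matrix onto the row space of S (acting on row
   vectors v |-> v *m proj S). *)
Definition adjmx p q (B : 'M[C]_(p, q)) : 'M[C]_(q, p) := (map_mx (@conjc R) B)^T.
Definition proj m (S : 'M[C]_m) : 'M[C]_m :=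
  let B := row_base S in adjmx B *m invmx (B *m adjmx B) *m B.

Definition frob m (M : 'M[C]_m) : R :=
  Num.sqrt (\sum_(i < m) \sum_(j < m) (complex.Re (M i j) ^+ 2 + complex.Im (M i j) ^+ 2)).

Definition gdist m (S T : 'M[C]_m) : R := frob (proj S - proj T).

Definition homogeneous_bundle n m k (phi : 'rV[R]_n -> 'M[C]_m) : Prop :=
  (forall xi, xi != 0 -> \rank (phi xi) = k) /\
  (forall xi, xi != 0 -> forall e : R, 0 < e -> exists2 d : R, 0 < d &
      forall eta, eta != 0 -> enorm (eta - xi) < d -> gdist (phi eta) (phi xi) < e) /\
  (forall xi (a : R), xi != 0 -> 0 < a -> (phi (a *: xi) == phi xi)%MS).

Definition holder_on_sphere n m (phi : 'rV[R]_n -> 'M[C]_m) (alpha : R) : Prop :=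
  exists c : R, forall u v : 'rV[R]_n, enorm u = 1 -> enorm v = 1 ->
    gdist (phi u) (phi v) <= c * (enorm (u - v)) `^ alpha.

Definition in_Mphi n m (phi : 'rV[R]_n -> 'M[C]_m) (mu : cmeasure n m) : Prop :=
  forall xi, xi != 0 -> (fourier mu xi <= phi xi)%MS.

(* N(A): unit directions v such that the projection of A onto span{v}
   is Lebesgue-null (identifying span{v} with R via t |-> t v). *)
Definition Nset n (A : set 'rV[R]_n) : set 'rV[R]_n :=
  [set v | enorm v = 1 /\
     (@lebesgue_measure R).-negligible [set dotv v x | x in A]].

End Defs.

(* Main.v *)
Require Import Defs.
From HB Require Import structures.
From mathcomp Require Import all_boot all_order all_algebra.
From mathcomp Require Import complex.
From mathcomp Require Import ring lra.
From mathcomp Require Import all_classical all_reals all_analysis.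
From mathcomp Require Import measurable_realfun.
Import Order.TTheory GRing.Theory Num.Theory.
Import numFieldNormedType.Exports.
Local Open Scope classical_set_scope.
Local Open Scope ring_scope.
Set Implicit Arguments.
Unset Strict Implicit.
Unset Printing Implicit Defensive.

(* Fix u in N(A), let Q be the orthogonal projection onto the complement of
   phi(u), and let nu be a coordinate of mu Q. For fixed xi the vector
   hat mu(xi + j u) lies in phi of a direction at distance O(1/j) from u, so
   hat nu(xi + j u) = O(j^-alpha), which is square summable over j >= 0 since
   alpha > 1/2. This forces nu to vanish on sets with null projection, by the
   F. and M. Riesz theorem in the form of Oksendal's proof: for a set F of zero
   content there are polynomials p_k, bounded on the circle, with p_k(e(t))
   tending to the indicator of the closure E of F modulo 1, and whose
   coefficients tend to 0 in l^2; hence the integral of p_k(e(<u,x>)) e(<xi,x>)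
   against nu tends both to 0 and to the Fourier transform at xi of nu restricted
   to E. By uniqueness of Fourier transforms nu vanishes on A :&: E, and F can be
   chosen so that A :\: E is arbitrarily small for all the measures involved. *)

(** Polynomials carry only the frequencies j >= 0, so decay along a single ray suffices: by
    Cauchy-Schwarz the integral of p_k(e(<u,x>)) e(<xi,x>) is at most the l^2 norm of the
    coefficients times that of the sequence hat nu(xi + j u). The rate j^-alpha arises because hat
    mu at a frequency of direction w is fixed by the projection onto phi(w), so Q sees only the
    difference of the projections onto phi(w) and phi(u). All xi are needed since A is not in
    general a union of level sets of <u,x>: the mass of E alone says nothing about A :&: E, whereas
    a vanishing Fourier transform kills the whole restriction to E. A null set can be dense, with a
    closure of full measure; zero content gives finite covers, hence functions with finitely many
    poles. No total variation is formed: nu stays a finite complex combination of positive measures,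
    and A :\: E is made small for each of them. *)

(** * Modulus, real part and imaginary part in [R[i]] *)

Section ComplexModulus.
Variable R : realType.
Local Notation Cx := R[i].
Local Notation nc := (@ComplexField.Normc.normc R).
Local Notation Re := (@complex.Re R).
Local Notation Im := (@complex.Im R).
Implicit Types z w : Cx.

Lemma nc_ge0 z : 0 <= nc z.
Proof. by case: z => a b /=; rewrite sqrtr_ge0. Qed.

Lemma sqr_nc z : nc z ^+ 2 = Re z ^+ 2 + Im z ^+ 2.
Proof. by case: z => a b /=; rewrite sqr_sqrtr// addr_ge0 ?sqr_ge0. Qed.

Lemma ncM z w : nc (z * w) = nc z * nc w.
Proof. exact: ComplexField.Normc.normcM. Qed.

Lemma ncV z : nc z^-1 = (nc z)^-1.
Proof. exact: ComplexField.Normc.normcV. Qed.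

Lemma nc0 : nc 0 = 0. Proof. exact: ComplexField.Normc.normc0. Qed.
Lemma nc1 : nc 1 = 1. Proof. exact: ComplexField.Normc.normc1. Qed.
Lemma nc0_eq0 z : nc z = 0 -> z = 0.
Proof. exact: ComplexField.Normc.eq0_normc. Qed.

Lemma ncD z w : nc (z + w) <= nc z + nc w.
Proof. exact: le_normcD. Qed.

Lemma ncN z : nc (- z) = nc z.
Proof. exact: normcN. Qed.

Lemma ncB z w : nc (z - w) = nc (w - z).
Proof. by rewrite -ncN opprB. Qed.

Lemma ncX z n : nc (z ^+ n) = nc z ^+ n.
Proof. by elim: n => [|n IH]; rewrite ?expr0 ?nc1// !exprS ncM IH. Qed.

Lemma nc_sum (I : Type) (s : seq I) (P : pred I) (F : I -> Cx) :
  nc (\sum_(i <- s | P i) F i) <= \sum_(i <- s | P i) nc (F i).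
Proof.
elim/big_ind2 : _ => [|x a y b xa yb|//]; first by rewrite nc0.
by apply: le_trans (ncD _ _) _; exact: lerD.
Qed.

Lemma nc_real (x : R) : nc (x%:C)%C = `|x|.
Proof. by rewrite /= expr0n /= addr0 sqrtr_sqr. Qed.

Lemma ger_nc (x : R) : 0 <= x -> nc (x%:C)%C = x.
Proof. by move=> x0; rewrite nc_real ger0_norm. Qed.

Lemma Re_le_nc z : `|Re z| <= nc z.
Proof.
by case: z => a b /=; rewrite -sqrtr_sqr ler_wsqrtr// lerDl sqr_ge0.
Qed.

Lemma Im_le_nc z : `|Im z| <= nc z.
Proof.
by case: z => a b /=; rewrite -sqrtr_sqr ler_wsqrtr// lerDr sqr_ge0.
Qed.

Lemma nc_le_ReIm z : nc z <= `|Re z| + `|Im z|.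
Proof.
rewrite -(@ler_pXn2r _ 2) ?nnegrE ?nc_ge0 ?addr_ge0// sqr_nc.
rewrite sqrrD !real_normK ?num_real//.
by rewrite lerD2r lerDl mulrn_wge0// mulr_ge0.
Qed.

Lemma cReD z w : Re (z + w) = Re z + Re w. Proof. by case: z w => [? ?] []. Qed.
Lemma cImD z w : Im (z + w) = Im z + Im w. Proof. by case: z w => [? ?] []. Qed.
Lemma cReN z : Re (- z) = - Re z. Proof. by case: z. Qed.
Lemma cImN z : Im (- z) = - Im z. Proof. by case: z. Qed.
Lemma cReM z w : Re (z * w) = Re z * Re w - Im z * Im w.
Proof. by case: z w => [? ?] []. Qed.
Lemma cImM z w : Im (z * w) = Re z * Im w + Im z * Re w.
Proof. by case: z w => [? ?] [? ?] /=; ring. Qed.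

Lemma cRe_sum (I : Type) (s : seq I) (P : pred I) (F : I -> Cx) :
  Re (\sum_(i <- s | P i) F i) = \sum_(i <- s | P i) Re (F i).
Proof. by elim/big_rec2 : _ => // i x y _ <-; rewrite cReD. Qed.

Lemma nc_conjc z : nc (z^*)%C = nc z.
Proof. by case: z => a b /=; rewrite sqrrN. Qed.

Lemma mulc_conjc z : z * (z^*)%C = ((nc z ^+ 2)%:C)%C.
Proof.
rewrite sqr_nc; case: z => a b; apply/eqP.
by rewrite eq_complex /=; apply/andP; split; apply/eqP; ring.
Qed.

Lemma neq0_nc_gt0 z : z != 0 -> 0 < nc z.
Proof.
move=> z0; rewrite lt_neqAle nc_ge0 andbT eq_sym; apply/negP => /eqP nz0.
by move: z0; rewrite (nc0_eq0 nz0) eqxx.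
Qed.

Lemma Re_gt0_neq0 z : 0 < Re z -> z != 0.
Proof. by apply: contraTneq => ->; rewrite ltxx. Qed.

End ComplexModulus.

(** * Uniform limits of polynomials on the closed unit disc *)

Section UniformPolynomials.
Variable R : realType.
Local Notation Cx := R[i].
Local Notation nc := (@ComplexField.Normc.normc R).
Local Notation Re := (@complex.Re R).
Local Notation Im := (@complex.Im R).
Implicit Types (z w : Cx) (f g : Cx -> Cx).

(** Membership in the disc algebra. Approximation is asked on the whole disc, not only on the
    circle, because the value at 0 enters the coefficient bound of [singular_polynomial]. *)
Definition disc_poly_approx f := forall e : R, 0 < e ->
  exists p : {poly Cx}, forall w, nc w <= 1 -> nc (p.[w] - f w) <= e.

Lemma horner_disc_bounded (p : {poly Cx}) :
  exists2 K : R, 0 < K & forall w, nc w <= 1 -> nc p.[w] <= K.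
Proof.
exists (1 + \sum_(i < size p) nc p`_i) => [|w w1].
  by rewrite ltr_pwDl// sumr_ge0// => i _; exact: nc_ge0.
rewrite horner_coef; apply: le_trans (nc_sum _ _ _) _.
rewrite -[leLHS]add0r lerD// ler_sum// => i _.
by rewrite ncM ncX ler_piMr ?nc_ge0// exprn_ile1 ?nc_ge0.
Qed.

Lemma disc_poly_approx_bounded f : disc_poly_approx f ->
  exists2 K : R, 0 < K & forall w, nc w <= 1 -> nc (f w) <= K.
Proof.
move=> /(_ 1 ltr01)[p pf]; have [K K0 pK] := horner_disc_bounded p.
exists (1 + K) => [|w w1]; first by rewrite addr_gt0.
rewrite -[f w](subrK p.[w]); apply: le_trans (ncD _ _) _.
by rewrite ncB lerD ?pf ?pK.
Qed.

Lemma disc_poly_approx_horner (p : {poly Cx}) : disc_poly_approx (horner p).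
Proof. by move=> e e0; exists p => w _; rewrite subrr nc0 ltW. Qed.

Lemma disc_poly_approx_ext f g : (forall w, nc w <= 1 -> f w = g w) ->
  disc_poly_approx f -> disc_poly_approx g.
Proof.
by move=> fg hf e e0; have [p pf] := hf e e0; exists p => w w1; rewrite -fg ?pf.
Qed.

Lemma disc_poly_approx_cst c : disc_poly_approx (fun=> c).
Proof.
apply: disc_poly_approx_ext (disc_poly_approx_horner c%:P) => w _.
by rewrite hornerC.
Qed.

Lemma disc_poly_approx_id : disc_poly_approx id.
Proof.
by apply: disc_poly_approx_ext (disc_poly_approx_horner 'X) => w _; rewrite hornerX.
Qed.

Lemma disc_poly_approxD f g : disc_poly_approx f -> disc_poly_approx g ->
  disc_poly_approx (fun w => f w + g w).
Proof.
move=> hf hg e e0; have e2 : 0 < e / 2 by rewrite divr_gt0.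
have [p pf] := hf _ e2; have [q qg] := hg _ e2.
exists (p + q) => w w1; rewrite hornerD opprD addrACA.
apply: le_trans (ncD _ _) _; rewrite [leRHS](splitr e).
by rewrite lerD ?pf ?qg.
Qed.

Lemma disc_poly_approxM f g : disc_poly_approx f -> disc_poly_approx g ->
  disc_poly_approx (fun w => f w * g w).
Proof.
move=> hf hg e e0.
have [K K0 fK] := disc_poly_approx_bounded hf.
have eK : 0 < e / 2 / K by rewrite !divr_gt0.
have [q qg] := hg _ eK.
have [L L0 qL] := horner_disc_bounded q.
have eL : 0 < e / 2 / L by rewrite !divr_gt0.
have [p pf] := hf _ eL.
exists (p * q) => w w1; rewrite hornerM.
have -> : p.[w] * q.[w] - f w * g w =
  (p.[w] - f w) * q.[w] + f w * (q.[w] - g w) by ring.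
apply: le_trans (ncD _ _) _; rewrite !ncM [leRHS](splitr e); apply: lerD.
  apply: le_trans (ler_pM (nc_ge0 _) (nc_ge0 _) (pf w w1) (qL w w1)) _.
  by rewrite divfK// gt_eqF.
apply: le_trans (ler_pM (nc_ge0 _) (nc_ge0 _) (fK w w1) (qg w w1)) _.
by rewrite mulrCA divff ?mulr1// gt_eqF.
Qed.

Lemma disc_poly_approx_sum (I : Type) (s : seq I) (F : I -> Cx -> Cx) :
  (forall i, disc_poly_approx (F i)) ->
  disc_poly_approx (fun w => \sum_(i <- s) F i w).
Proof.
move=> hF; elim: s => [|i s IH].
  apply: disc_poly_approx_ext (disc_poly_approx_cst 0) => w _; by rewrite big_nil.
apply: disc_poly_approx_ext (disc_poly_approxD (hF i) IH) => w _.
by rewrite big_cons.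
Qed.

Lemma disc_poly_approxX f n : disc_poly_approx f ->
  disc_poly_approx (fun w => f w ^+ n).
Proof.
move=> hf; elim: n => [|n IH].
  by apply: disc_poly_approx_ext (disc_poly_approx_cst 1) => w _; rewrite expr0.
apply: disc_poly_approx_ext (disc_poly_approxM hf IH) => w _.
by rewrite exprS.
Qed.

Lemma disc_poly_approx_lim f :
  (forall e : R, 0 < e -> exists2 g, disc_poly_approx g &
     forall w, nc w <= 1 -> nc (g w - f w) <= e) -> disc_poly_approx f.
Proof.
move=> H e e0; have e2 : 0 < e / 2 by rewrite divr_gt0.
have [g hg gf] := H _ e2; have [p pg] := hg _ e2; exists p => w w1.
have -> : p.[w] - f w = (p.[w] - g w) + (g w - f w) by ring.
apply: le_trans (ncD _ _) _; rewrite [leRHS](splitr e).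
by rewrite lerD ?pg ?gf.
Qed.

(* Writing 1/f = c/(1 - (1 - c f)) with c small makes |1 - c f| < 1 uniformly. *)
Lemma disc_poly_approxV f (d : R) : 0 < d -> disc_poly_approx f ->
  (forall w, nc w <= 1 -> d <= Re (f w)) -> disc_poly_approx (fun w => (f w)^-1).
Proof.
move=> d0 hf fd.
have [X X0 fX] := disc_poly_approx_bounded hf.
have dX : d <= X.
  apply: le_trans (fd 0 _) _; first by rewrite nc0.
  apply: le_trans (ler_norm _) _; apply: le_trans (Re_le_nc _) _.
  by apply: fX; rewrite nc0.
(* This [c] minimises [1 - 2 * c * d + c ^+ 2 * X ^+ 2], which bounds the squared modulus of [q w];
   [t] is the minimum. *)
pose c := d / X ^+ 2.
pose q w := 1 - (c%:C)%C * f w.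
pose t := 1 - d ^+ 2 / X ^+ 2.
have X20 : 0 < X ^+ 2 by rewrite exprn_gt0.
have t0 : 0 <= t by rewrite /t subr_ge0 ler_pdivrMr// mul1r lerXn2r ?nnegrE ?(ltW d0) ?(ltW X0).
have t1 : t < 1 by rewrite /t ltrBlDr ltrDl divr_gt0// exprn_gt0.
have c0 : 0 < c by rewrite divr_gt0.
have qt w : nc w <= 1 -> nc (q w) ^+ 2 <= t.
  move=> w1; have := fd w w1; have := fX w w1 => h1 h2.
  have : nc (f w) ^+ 2 <= X ^+ 2 by rewrite lerXn2r ?nnegrE ?nc_ge0 ?(ltW X0).
  rewrite !sqr_nc /q; case: (f w) h2 => a b /= h2 h3.
  have -> : Re (1 - (c +i* 0)%C * (a +i* b)%C) ^+ 2 + Im (1 - (c +i* 0)%C * (a +i* b)%C) ^+ 2 =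
     1 - 2 * c * a + c ^+ 2 * (a ^+ 2 + b ^+ 2) by rewrite /=; ring.
  apply: (@le_trans _ _ (1 - 2 * c * d + c ^+ 2 * X ^+ 2)).
    by rewrite lerD ?ler_wpM2l ?sqr_ge0// lerB// ler_wpM2l// mulr_ge0// ltW.
  by rewrite /t /c le_eqVlt; apply/orP; left; apply/eqP; field; rewrite gt_eqF.
have fge w : nc w <= 1 -> d <= nc (f w).
  move=> w1; apply: le_trans (fd w w1) _; apply: le_trans (ler_norm _) _.
  exact: Re_le_nc.
have f_neq0 w : nc w <= 1 -> f w != 0.
  by move=> w1; apply: Re_gt0_neq0; exact: lt_le_trans (fd w w1).
apply: disc_poly_approx_lim => e e0.
have [N tN] : exists N, t ^+ N <= e * d.
  have ed : 0 < e * d by rewrite mulr_gt0.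
  have : `|t| < 1 by rewrite ger0_norm.
  move=> /cvg_expr/cvgrPdist_le/(_ _ ed)[N _ /(_ N (leqnn N))].
  by rewrite sub0r normrN ger0_norm ?exprn_ge0//; exists N.
(* Partial sum of the geometric series for c / (1 - q); its length is [N.*2] because [t] bounds the
   square of the modulus of [q w]. *)
exists (fun w => (c%:C)%C * \sum_(j < N.*2) q w ^+ j).
  apply: disc_poly_approxM (disc_poly_approx_cst _) _.
  apply: disc_poly_approx_sum => j; apply: disc_poly_approxX.
  apply: (@disc_poly_approx_ext (fun w => 1 + (- (c%:C)%C) * f w)) => [w _|].
    by rewrite /q mulNr.
  apply: disc_poly_approxD (disc_poly_approx_cst _) _.
  exact: disc_poly_approxM (disc_poly_approx_cst _) hf.
move=> w w1; have f0 := f_neq0 w w1.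
have -> : (c%:C)%C * (\sum_(j < N.*2) q w ^+ j) - (f w)^-1 = - (q w ^+ N.*2 / f w).
  have cf : (c%:C)%C * f w = 1 - q w by rewrite /q subKr.
  apply: (mulIf f0); rewrite mulrBl mulVf// mulNr mulfVK// mulrAC cf.
  by rewrite -(opprB (q w) 1) mulNr -subrX1; ring.
rewrite ncN ncM ncV ncX ler_pdivrMr ?neq0_nc_gt0//.
apply: le_trans (_ : e * d <= _); last by rewrite ler_wpM2l ?fge// ltW.
apply: le_trans tN; rewrite -mul2n exprM.
by rewrite lerXn2r ?nnegrE ?exprn_ge0 ?nc_ge0// qt.
Qed.

End UniformPolynomials.

(** * The character exp(-2 pi i t) and Fourier analysis on roots of unity *)

Section CircleCharacter.
Variable R : realType.
Local Notation Cx := R[i].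
Local Notation nc := (@ComplexField.Normc.normc R).
Local Notation Re := (@complex.Re R).
Local Notation Im := (@complex.Im R).
Implicit Types (s t : R) (w : Cx).

Lemma conjcX w n : ((w ^+ n)^*)%C = (w^*)%C ^+ n.
Proof. exact: rmorphXn. Qed.

Lemma conjc_sum (I : Type) (r : seq I) (P : pred I) (F : I -> Cx) :
  ((\sum_(i <- r | P i) F i)^*)%C = \sum_(i <- r | P i) ((F i)^*)%C.
Proof. exact: rmorph_sum. Qed.

(** This is exp(-2 pi i t); with this sign the integral of [chi xi] is the Fourier transform at
    [xi]. *)
Definition echar t : Cx := (cos (2 * pi * t) -i* sin (2 * pi * t))%C.

Lemma echar0 : echar 0 = 1.
Proof. by rewrite /echar mulr0 cos0 sin0 oppr0. Qed.

Lemma echarD s t : echar (s + t) = echar s * echar t.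
Proof.
by apply/eqP; rewrite eq_complex /= mulrDr cosD sinD; apply/andP; split; apply/eqP; ring.
Qed.

Lemma echarN t : echar (- t) = (echar t)^*%C.
Proof. by rewrite /echar /= mulrN cosN sinN !opprK. Qed.

Lemma nc_echar t : nc (echar t) = 1.
Proof. by rewrite /= sqrrN cos2Dsin2 sqrtr1. Qed.

Lemma echar_conj t : echar t * (echar t)^*%C = 1.
Proof. by rewrite mulc_conjc nc_echar expr1n. Qed.

Lemma echarX t n : echar t ^+ n = echar (n%:R * t).
Proof.
elim: n => [|n IH]; first by rewrite expr0 mul0r echar0.
by rewrite exprS IH -echarD -addn1 natrD mulrDl mul1r addrC.
Qed.

Lemma echar1 : echar 1 = 1.
Proof. by rewrite /echar mulr1 mulr_natl cos2pi sin2pi oppr0. Qed.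

Lemma echar_nat n : echar n%:R = 1.
Proof. by rewrite -[n%:R]mulr1 -echarX echar1 expr1n. Qed.

Lemma echar_neq1 t : 0 < t < 1 -> echar t != 1.
Proof.
move=> /andP[t0 t1]; apply/eqP => /(congr1 Re) /=.
have -> : 2 * pi * t = (pi * t) *+ 2 by ring.
rewrite cos_mulr2n => h.
have : 0 < sin (pi * t).
  by rewrite sin_gt0_pi// mulr_gt0 ?pi_gt0//= gtr_pMr ?pi_gt0.
have := cos2Dsin2 (pi * t); nra.
Qed.

Lemma cos_lipschitz s t : `|cos s - cos t| <= `|s - t|.
Proof.
suff H (a b : R) : b <= a -> `|cos a - cos b| <= `|a - b|.
  by case/orP: (le_total t s) => /H//; rewrite distrC (distrC t).
move=> ab; have [|c _ ->] := MVT_segment (f := @cos R) (df := fun x => - sin x) ab.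
  by apply: continuous_subspaceT => x; exact: continuous_cos.
by rewrite normrM normrN ler_piMl// sin_max.
Qed.

Lemma sin_lipschitz s t : `|sin s - sin t| <= `|s - t|.
Proof.
rewrite -!cosBpihalf; apply: le_trans (cos_lipschitz _ _) _.
by have -> : s - pi / 2 - (t - pi / 2) = s - t by ring.
Qed.

Lemma echar_lipschitz s t : nc (echar s - echar t) <= 4 * pi * `|s - t|.
Proof.
apply: le_trans (nc_le_ReIm _) _ => /=.
have -> : 4 * pi * `|s - t| = `|2 * pi * s - 2 * pi * t| + `|2 * pi * s - 2 * pi * t|.
  rewrite -mulrBr normrM ger0_norm ?mulr_ge0 ?pi_ge0//; ring.
by rewrite -opprD normrN lerD ?cos_lipschitz ?sin_lipschitz.
Qed.

(** The summand is the k-th power of z, the product of e(i/N) and the conjugate of e(j/N). When i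
    and j differ, z is an N-th root of unity other than 1, and the geometric sum vanishes. *)
Lemma echar_sum_orthogonal (N : nat) (i j : 'I_N) :
  \sum_(k < N) echar (k%:R / N%:R) ^+ i * (echar (k%:R / N%:R) ^+ j)^*%C
  = (i == j)%:R * N%:R.
Proof.
have N0 : (0 < N)%N by case: N i {j} => [[]//|].
have N0' : (N%:R : R) != 0 by rewrite pnatr_eq0 -lt0n.
pose x (l : nat) := echar (l%:R / N%:R).
have xX (k : 'I_N) (l : 'I_N) : echar (k%:R / N%:R) ^+ l = x l ^+ k.
  by rewrite /x !echarX; congr echar; rewrite mulrCA.
have xN l : x l ^+ N = 1 by rewrite /x echarX mulrC divfK// echar_nat.
pose z := x i * (x j)^*%C.
transitivity (\sum_(k < N) z ^+ k).
  by apply: eq_bigr => k _; rewrite (xX k i) (xX k j) exprMn conjcX.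
have [ij|ij] := eqVneq i j.
  rewrite (eq_bigr (fun=> 1)) => [|k _].
    by rewrite sumr_const card_ord mul1r.
  by rewrite /z /x ij echar_conj expr1n.
rewrite mul0r.
have zN : z ^+ N = 1 by rewrite /z exprMn xN -conjcX xN mul1r conjc1.
suff z1 : z - 1 != 0 by apply: (mulfI z1); rewrite -subrX1 zN subrr mulr0.
rewrite subr_eq0.
(* Exchanging i and j conjugates [z]; with i > j the quotient (i - j)/N lies strictly between 0 and
   1. *)
wlog ltij : i j ij @z {zN} / (j < i)%N.
  move=> H; have [/H|ltij|/val_inj/eqP] := ltngtP j i; [exact| |].
    have := H j i; rewrite eq_sym ij ltij => /(_ isT isT).
    apply: contra => /eqP z1.
    have -> : x j * (x i)^*%C = (x i * (x j)^*%C)^*%C.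
      case: (x i) (x j) => [? ?] [? ?]; apply/eqP; rewrite eq_complex /=.
      by apply/andP; split; apply/eqP; ring.
    by rewrite -/z z1 conjc1.
  by rewrite eq_sym (negPf ij).
rewrite /z /x -echarN -echarD -mulrBl -natrB ?(ltnW ltij)//; apply: echar_neq1.
have N0r : 0 < (N%:R : R) by rewrite ltr0n.
rewrite divr_gt0 ?ltr0n ?subn_gt0//= ltr_pdivrMr// mul1r ltr_nat.
exact: leq_ltn_trans (leq_subr _ _) (ltn_ord i).
Qed.

Local Arguments conjc : simpl never.

(** Sampling at the N-th roots of unity is exact below degree N, so a finite sum stands for the mean
    of |p|^2 over the circle and no integration is involved. *)
Lemma poly_parseval (p : {poly Cx}) (N : nat) : (size p <= N)%N ->
  \sum_(k < N) nc p.[echar (k%:R / N%:R)] ^+ 2 =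
  N%:R * \sum_(i < N) nc p`_i ^+ 2.
Proof.
move=> pN; apply: complexI; rewrite rmorphM rmorph_nat !rmorph_sum/=.
transitivity (\sum_(k < N) \sum_(i < N) \sum_(j < N) p`_i * (p`_j)^*%C *
   (echar (k%:R / N%:R) ^+ i * (echar (k%:R / N%:R) ^+ j)^*%C)).
  apply: eq_bigr => k _; rewrite -mulc_conjc (horner_coef_wide _ pN).
  rewrite mulr_suml; apply: eq_bigr => i _; rewrite conjc_sum mulr_sumr.
  by apply: eq_bigr => j _; rewrite rmorphM; ring.
rewrite exchange_big mulr_sumr; apply: eq_bigr => i _.
rewrite exchange_big (bigD1 i)//= [X in _ + X]big1 => [|j ji].
  by rewrite addr0 -mulr_sumr echar_sum_orthogonal eqxx mul1r mulc_conjc mulrC.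
by rewrite -mulr_sumr echar_sum_orthogonal eq_sym (negPf ji) mul0r mulr0.
Qed.

Lemma poly_mean (p : {poly Cx}) (N : nat) : (size p <= N)%N -> (0 < N)%N ->
  \sum_(k < N) p.[echar (k%:R / N%:R)] = N%:R * p.[0].
Proof.
move=> pN N0; have [l l0] : exists l : 'I_N, l = 0%N :> nat by exists (Ordinal N0).
transitivity (\sum_(k < N) \sum_(i < N) p`_i *
   (echar (k%:R / N%:R) ^+ i * (echar (k%:R / N%:R) ^+ l)^*%C)).
  apply: eq_bigr => k _; rewrite (horner_coef_wide _ pN).
  by apply: eq_bigr => i _; rewrite l0 expr0 conjc1 mulr1.
rewrite exchange_big (bigD1 l)//= [X in _ + X]big1 => [|i il].
  by rewrite addr0 -mulr_sumr echar_sum_orthogonal eqxx mul1r horner_coef0 l0 mulrC.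
by rewrite -mulr_sumr echar_sum_orthogonal (negPf il) mul0r mulr0.
Qed.

(** Average the hypothesis over roots of unity: Parseval turns the left side into the squared
    coefficients, and the mean of [p] is its value at 0. *)
Lemma sum_sqr_coef_le (p : {poly Cx}) (d : R) :
  (forall w, nc w = 1 -> nc p.[w] ^+ 2 <= Re p.[w] + d) ->
  \sum_(i < size p) nc p`_i ^+ 2 <= Re p.[0] + d.
Proof.
move=> H; pose N := (size p).+1.
have N0 : 0 < (N%:R : R) by rewrite ltr0n.
apply: (@le_trans _ _ (\sum_(i < N) nc p`_i ^+ 2)).
  by rewrite big_ord_recr /= lerDl sqr_ge0.
have pN : (size p <= N)%N by exact: leqnSn.
rewrite -(ler_pM2l N0) -poly_parseval//.
have -> : N%:R * (Re p.[0] + d) = \sum_(k < N) (Re p.[echar (k%:R / N%:R)] + d).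
  rewrite big_split /= -cRe_sum poly_mean// sumr_const card_ord mulrDr mulr_natl.
  congr (_ + _); last by rewrite mulr_natl.
  by rewrite cReM -(rmorph_nat (@real_complex R)) /= mul0r subr0 mulr_natl.
by apply: ler_sum => k _; apply: H; rewrite nc_echar.
Qed.

End CircleCharacter.

(** * Polynomials close to 1 near given points of the circle and small away from them *)

Section SingularPolynomials.
Variable R : realType.
Local Notation Cx := R[i].
Local Notation nc := (@ComplexField.Normc.normc R).
Local Notation Re := (@complex.Re R).
Local Notation Im := (@complex.Im R).
Implicit Types (z w : Cx) (s : seq (Cx * R)).

Lemma cReV z : Re z^-1 = Re z / nc z ^+ 2.
Proof. by rewrite sqr_nc; case: z. Qed.

Lemma cReZ (x : R) z : Re ((x%:C)%C * z) = x * Re z.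
Proof. by rewrite cReM /= mul0r subr0. Qed.

(** For |c| = 1 and r > 0, the function [pole (c, r)] has its pole at (1 + r) c, just outside the
    disc, and takes the value 1 at c. On the disc its real part is nonnegative, as the map z/(1+z)
    requires. *)
Definition pole_den (cr : Cx * R) w : Cx := 1 + (cr.2%:C)%C - w * (cr.1)^*%C.
Definition pole (cr : Cx * R) w : Cx := (cr.2%:C)%C / pole_den cr w.

Section one_pole.
Variables (cr : Cx * R).
Hypotheses (c1 : nc cr.1 = 1) (r0 : 0 < cr.2).

Lemma le_Re_pole_den w : nc w <= 1 -> cr.2 <= Re (pole_den cr w).
Proof.
move=> w1; rewrite /pole_den !cReD cReN /=.
have := Re_le_nc (w * (cr.1)^*%C); rewrite ncM nc_conjc c1 mulr1 ler_norml => /andP[_ h].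
by rewrite addrAC lerDr subr_ge0 (le_trans h).
Qed.

Lemma pole_den_neq0 w : nc w <= 1 -> pole_den cr w != 0.
Proof. by move=> /le_Re_pole_den h; apply: Re_gt0_neq0; exact: lt_le_trans h. Qed.

Lemma Re_pole_ge0 w : nc w <= 1 -> 0 <= Re (pole cr w).
Proof.
move=> w1; rewrite /pole cReZ cReV mulr_ge0 ?(ltW r0)// divr_ge0 ?sqr_ge0//.
by apply: le_trans (le_Re_pole_den w1); exact: ltW.
Qed.

Lemma disc_poly_approx_pole : disc_poly_approx (pole cr).
Proof.
apply: disc_poly_approxM (disc_poly_approx_cst _) _.
apply: (disc_poly_approxV r0); last exact: le_Re_pole_den.
apply: (@disc_poly_approx_ext _ (fun w => (1 + (cr.2%:C)%C) + w * - (cr.1)^*%C)).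
  by move=> w _; rewrite mulrN.
apply: disc_poly_approxD (disc_poly_approx_cst _) _.
exact: disc_poly_approxM (@disc_poly_approx_id R) (disc_poly_approx_cst _).
Qed.

Lemma nc_sub_circle w : nc (1 - w * (cr.1)^*%C) = nc (w - cr.1).
Proof.
rewrite ncB -[1](_ : cr.1 * (cr.1)^*%C = 1); last by rewrite mulc_conjc c1 expr1n.
by rewrite -mulrBl ncM nc_conjc c1 mulr1.
Qed.

(** Near c the denominator has real part at least r and modulus at most 2 r, so the real part of the
    quotient is at least r * r / (2 r)^2. *)
Lemma Re_pole_near w : nc w <= 1 -> nc (w - cr.1) <= cr.2 -> 4^-1 <= Re (pole cr w).
Proof.
move=> w1 wr; rewrite /pole cReZ cReV.
have hr := le_Re_pole_den w1.
have hb : nc (pole_den cr w) <= 2 * cr.2.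
  rewrite /pole_den addrAC; apply: le_trans (ncD _ _) _.
  by rewrite nc_sub_circle ger_nc ?(ltW r0)// mulr_natl mulr2n lerD2r.
have b0 := neq0_nc_gt0 (pole_den_neq0 w1).
rewrite mulrA ler_pdivlMr ?exprn_gt0//.
have := lerXn2r 2 (nc_ge0 _) _ hb; rewrite nnegrE => /(_ _)/=.
have -> : 0 <= 2 * cr.2 by rewrite mulr_ge0// ltW.
move=> /(_ isT) h; apply: (@le_trans _ _ (4^-1 * (2 * cr.2) ^+ 2)).
  by rewrite ler_wpM2l.
have -> : 4^-1 * (2 * cr.2) ^+ 2 = cr.2 * cr.2 by field.
by rewrite ler_wpM2l// ltW.
Qed.

(** Without r the denominator has modulus |w - c| and nonnegative real part, so adding r > 0 only
    enlarges the modulus. *)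
Lemma nc_pole_far w (d : R) : nc w <= 1 -> 0 < d -> d <= nc (w - cr.1) ->
  nc (pole cr w) <= cr.2 / d.
Proof.
move=> w1 d0 wd; rewrite /pole ncM ncV ger_nc ?(ltW r0)//.
rewrite ler_wpM2l ?(ltW r0)// lef_pV2 ?posrE ?neq0_nc_gt0 ?pole_den_neq0//.
apply: (le_trans wd); rewrite -nc_sub_circle.
rewrite -(@ler_pXn2r _ 2) ?nnegrE ?nc_ge0// !sqr_nc.
have := Re_le_nc (w * (cr.1)^*%C); rewrite ncM nc_conjc c1 mulr1 => /le_trans/(_ w1) h.
rewrite /pole_den; move: (w * _) h => [a b] /=.
rewrite ler_norml => /andP[_ h]; rewrite addr0; apply: lerD => //.
by move: cr.2 r0 => r r0'; nra.
Qed.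

Lemma nc_pole0 : nc (pole cr 0) <= cr.2.
Proof.
rewrite /pole /pole_den mul0r subr0 ncM ncV ger_nc ?(ltW r0)//.
rewrite ler_piMr ?(ltW r0)// invf_le1; last first.
  by apply: lt_le_trans (Re_le_nc _); rewrite /= gtr0_norm addr_gt0.
by apply: le_trans (Re_le_nc _); rewrite /= gtr0_norm ?addr_gt0// lerDl ltW.
Qed.

End one_pole.

(* For Re z >= 0, z/(1+z) lies in the disc with diameter [0,1]. *)
Lemma cayley_bound z : 0 <= Re z -> nc (z / (1 + z)) ^+ 2 <= Re (z / (1 + z)).
Proof.
move=> z0; have d0 : 0 < Re (1 + z) by rewrite cReD /= ltr_pwDl.
have n0 := neq0_nc_gt0 (Re_gt0_neq0 d0).
rewrite ncM ncV exprMn exprVn.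
have -> : Re (z / (1 + z)) = (nc z ^+ 2 + Re z) / nc (1 + z) ^+ 2.
  rewrite !sqr_nc; case: z z0 d0 {n0} => a b /= a0 d0.
  have nz : (1 + a) ^+ 2 + (0 + b) ^+ 2 != 0.
    by rewrite gt_eqF// ltr_pwDl ?sqr_ge0// exprn_gt0.
  by rewrite add0r in nz; rewrite !add0r; field.
by rewrite ler_wpM2r ?invr_ge0 ?sqr_ge0// lerDl.
Qed.

Lemma cayley_le1 z : 0 <= Re z -> nc (z / (1 + z)) <= 1.
Proof.
move=> /cayley_bound h; have := Re_le_nc (z / (1 + z)).
rewrite ler_norml => /andP[_ h2]; have := nc_ge0 (z / (1 + z)); nra.
Qed.

Lemma nc_1D_ge z : 0 <= Re z -> 1 + Re z <= nc (1 + z).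
Proof.
move=> z0; apply: le_trans (Re_le_nc _); rewrite cReD/=; exact: ler_norm.
Qed.

Lemma cayley_le z : 0 <= Re z -> nc (z / (1 + z)) <= nc z.
Proof.
move=> z0; rewrite ncM ncV ler_piMr ?nc_ge0//.
have h : 1 <= nc (1 + z) by apply: le_trans (nc_1D_ge z0); rewrite lerDl.
by rewrite invf_le1 ?(lt_le_trans ltr01 h).
Qed.

Lemma cayley_near1 z (m : R) : 0 <= m -> m <= Re z -> nc (1 - z / (1 + z)) <= (1 + m)^-1.
Proof.
move=> m0 mz; have z0 := le_trans m0 mz.
have h := nc_1D_ge z0.
have n0 : 0 < nc (1 + z) by apply: lt_le_trans h; rewrite ltr_pwDl.
have -> : 1 - z / (1 + z) = (1 + z)^-1.
  have nz : 1 + z != 0 by apply: contraTneq n0 => ->; rewrite nc0 ltxx.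
  by field.
by rewrite ncV lef_pV2 ?posrE ?ltr_pwDl//; apply: le_trans h; rewrite lerD2l.
Qed.

(* The polynomial approximates h = z/(1+z) with z = M * sum of the poles; the
   coefficient bound comes from |h|^2 <= Re h, the mean value of Re h over the
   circle being h(0). *)
Lemma singular_polynomial s (M e : R) :
  (forall cr, cr \in s -> nc cr.1 = 1) -> (forall cr, cr \in s -> 0 < cr.2) ->
  0 < M -> 0 < e <= 1 ->
  exists p : {poly Cx},
  [/\ forall w, nc w = 1 -> nc p.[w] <= 1 + e,
      forall w cr, nc w = 1 -> cr \in s -> nc (w - cr.1) <= cr.2 ->
         nc (1 - p.[w]) <= (1 + M / 4)^-1 + e,
      forall w (d : R), nc w = 1 -> 0 < d ->
         (forall cr, cr \in s -> d <= nc (w - cr.1)) ->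
         nc p.[w] <= M * (\sum_(cr <- s) cr.2) / d + e &
      \sum_(i < size p) nc p`_i ^+ 2 <= M * (\sum_(cr <- s) cr.2) + 5 * e].
Proof.
move=> s1 s0 M0 /andP[e0 e1].
pose z w := (M%:C)%C * \sum_(cr <- s) pole cr w.
have z_ge0 w : nc w <= 1 -> 0 <= Re (z w).
  move=> w1; rewrite /z cReZ mulr_ge0 ?(ltW M0)// cRe_sum big_seq sumr_ge0// => cr crs.
  by apply: Re_pole_ge0; [exact: s1|exact: s0|].
have z_le (d : R) w : 0 < d -> (forall cr, cr \in s -> nc (pole cr w) <= cr.2 / d) ->
    nc (z w) <= M * (\sum_(cr <- s) cr.2) / d.
  move=> d0 H; rewrite /z ncM ger_nc ?(ltW M0)// -mulrA ler_wpM2l ?(ltW M0)//.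
  apply: le_trans (nc_sum _ _ _) _; rewrite mulr_suml big_seq [leRHS]big_seq.
  by apply: ler_sum.
have hz : disc_poly_approx z.
  apply: disc_poly_approxM (disc_poly_approx_cst _) _.
  apply: (@disc_poly_approx_ext _ (fun w => \sum_(i < size s) pole (nth (0, 1) s i) w)).
    by move=> w _; rewrite (big_nth (0, 1)) big_mkord.
  apply: disc_poly_approx_sum => i; apply: disc_poly_approx_pole.
    by apply: s1; exact: mem_nth.
  by apply: s0; exact: mem_nth.
have hh : disc_poly_approx (fun w => z w / (1 + z w)).
  apply: (disc_poly_approxM hz); apply: (disc_poly_approxV ltr01).
    exact: disc_poly_approxD (disc_poly_approx_cst _) hz.
  by move=> w w1; rewrite cReD /= lerDl z_ge0.
have [p ph] := hh e e0; exists p; split.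
- move=> w w1; have w1' : nc w <= 1 by rewrite w1.
  rewrite -[p.[w]](subrK (z w / (1 + z w))) addrC; apply: le_trans (ncD _ _) _.
  by rewrite lerD ?ph ?cayley_le1 ?z_ge0.
- move=> w cr w1 crs wr; have w1' : nc w <= 1 by rewrite w1.
  have -> : 1 - p.[w] = (1 - z w / (1 + z w)) + (z w / (1 + z w) - p.[w]).
    by rewrite addrA subrK.
  apply: le_trans (ncD _ _) _; rewrite [nc (_ - p.[w])]ncB lerD ?ph//.
  apply: cayley_near1; first by rewrite divr_ge0// ltW.
  rewrite /z cReZ ler_wpM2l ?(ltW M0)// cRe_sum (big_rem cr)//=.
  rewrite -[leLHS]addr0 lerD ?Re_pole_near ?s1 ?s0// big_seq sumr_ge0// => c /mem_rem cs.
  by apply: Re_pole_ge0; [exact: s1|exact: s0|].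
- move=> w d w1 d0 H; have w1' : nc w <= 1 by rewrite w1.
  rewrite -[p.[w]](subrK (z w / (1 + z w))) addrC; apply: le_trans (ncD _ _) _.
  rewrite lerD ?ph//; apply: le_trans (cayley_le (z_ge0 w w1')) _.
  by apply: z_le => // cr crs; apply: nc_pole_far; rewrite ?s1 ?s0 ?H.
(* With |p - h| <= e, |h| <= 1 and e <= 1 one has |p|^2 <= |h|^2 + 2 e + e^2 <= Re h + 3 e <= Re p +
   4 e. The fifth e is spent on replacing p(0) by h(0). *)
- apply: (@le_trans _ _ (Re p.[0] + 4 * e)).
    apply: sum_sqr_coef_le => w w1; have w1' : nc w <= 1 by rewrite w1.
    have := cayley_bound (z_ge0 w w1'); have := cayley_le1 (z_ge0 w w1').
    have := ph w w1'; move: (z w / _) => h ph' h1 hRe.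
    have pn : nc p.[w] <= nc h + e.
      by rewrite -[p.[w]](subrK h) addrC; apply: le_trans (ncD _ _) _; rewrite lerD2l.
    have := Re_le_nc (p.[w] - h); rewrite cReD cReN ler_norml => /andP[h3 _].
    have := nc_ge0 p.[w]; have := nc_ge0 h.
    move: (nc p.[w]) (nc h) (Re h) (Re p.[w]) (nc (_ - _)) pn h1 hRe h3 ph'.
    move=> np nh rh rp q.
    nra.
  have n0 : nc (0 : Cx) <= 1 by rewrite nc0.
  have := ph 0 n0; have := cayley_le (z_ge0 0 n0).
  have := z_le 1 0 ltr01; rewrite divr1 => H.
  have /H {H} : forall cr, cr \in s -> nc (pole cr 0) <= cr.2 / 1.
    by move=> cr crs; rewrite divr1 nc_pole0 ?s0.
  move: (z 0 / _) => h h1 h2 h3.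
  have := Re_le_nc (p.[0] - h); rewrite cReD cReN ler_norml => /andP[_ h4].
  have := Re_le_nc h; rewrite ler_norml => /andP[_ h5].
  lra.
Qed.

End SingularPolynomials.

(** * Convergence of complex sequences *)

Section ComplexConvergence.
Variable R : realType.
Local Notation Cx := R[i].
Local Notation nc := (@ComplexField.Normc.normc R).
Local Notation Re := (@complex.Re R).
Local Notation Im := (@complex.Im R).

Definition ccvg (u : nat -> Cx) (l : Cx) : Prop :=
  forall e : R, 0 < e -> exists N, forall k, (N <= k)%N -> nc (u k - l) <= e.

Lemma ccvg_Re u l : ccvg u l -> (fun k => Re (u k)) @ \oo --> Re l.
Proof.
move=> ul; apply/cvgrPdist_le => e e0; have [N HN] := ul e e0.
exists N => // k /= Nk; rewrite distrC -cReN -cReD.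
exact: le_trans (Re_le_nc _) (HN _ Nk).
Qed.

Lemma ccvg_Im u l : ccvg u l -> (fun k => Im (u k)) @ \oo --> Im l.
Proof.
move=> ul; apply/cvgrPdist_le => e e0; have [N HN] := ul e e0.
exists N => // k /= Nk; rewrite distrC -cImN -cImD.
exact: le_trans (Im_le_nc _) (HN _ Nk).
Qed.

Lemma ccvg_ReIm u l : (fun k => Re (u k)) @ \oo --> Re l ->
  (fun k => Im (u k)) @ \oo --> Im l -> ccvg u l.
Proof.
move=> /cvgrPdist_le hr /cvgrPdist_le hi e e0.
have e2 : 0 < e / 2 by rewrite divr_gt0.
have [N1 _ H1] := hr _ e2; have [N2 _ H2] := hi _ e2.
exists (maxn N1 N2) => k; rewrite geq_max => /andP[k1 k2].
apply: le_trans (nc_le_ReIm _) _; rewrite !cReD !cImD cReN cImN [leRHS](splitr e).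
by rewrite lerD// distrC; [exact: H1|exact: H2].
Qed.

Lemma ccvg_cst c : ccvg (fun=> c) c.
Proof. by move=> e e0; exists 0%N => k _; rewrite subrr nc0 ltW. Qed.

Lemma ccvgD u v l m : ccvg u l -> ccvg v m -> ccvg (fun k => u k + v k) (l + m).
Proof.
move=> ul vm e e0; have e2 : 0 < e / 2 by rewrite divr_gt0.
have [N1 H1] := ul _ e2; have [N2 H2] := vm _ e2.
exists (maxn N1 N2) => k; rewrite geq_max => /andP[k1 k2].
rewrite opprD addrACA; apply: le_trans (ncD _ _) _; rewrite [leRHS](splitr e).
by rewrite lerD ?H1 ?H2.
Qed.

Lemma ccvgMl c u l : ccvg u l -> ccvg (fun k => c * u k) (c * l).
Proof.
move=> ul e e0; have c0 : 0 < nc c + 1 by rewrite ltr_wpDl ?nc_ge0.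
have [N HN] := ul _ (divr_gt0 e0 c0); exists N => k /HN h.
rewrite -mulrBr ncM; apply: (@le_trans _ _ ((nc c + 1) * (e / (nc c + 1)))).
  by rewrite ler_pM ?nc_ge0// lerDl.
by rewrite mulrCA divff ?mulr1// gt_eqF.
Qed.

Lemma ccvg_sum (I : Type) (r : seq I) (u : I -> nat -> Cx) (l : I -> Cx) :
  (forall i, ccvg (u i) (l i)) ->
  ccvg (fun k => \sum_(i <- r) u i k) (\sum_(i <- r) l i).
Proof.
move=> H; elim: r => [|i r IH].
  by rewrite big_nil; under eq_fun do rewrite big_nil; exact: ccvg_cst.
by rewrite big_cons; under eq_fun do rewrite big_cons; exact: ccvgD.
Qed.

Lemma ccvg_le u l (K : R) : ccvg u l -> (forall k, nc (u k) <= K) -> nc l <= K.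
Proof.
move=> ul uK; apply/ler_addgt0Pl => e e0; have [N HN] := ul e e0.
rewrite -[l](subrK (u N)); apply: le_trans (ncD _ _) _.
by rewrite ncB lerD ?HN.
Qed.

Lemma ccvg0_eq0 u l : ccvg u l -> ccvg u 0 -> l = 0.
Proof.
move=> ul u0; apply: nc0_eq0; apply/eqP; rewrite eq_le nc_ge0 andbT.
apply/ler_addgt0Pl => e e0; have e2 : 0 < e / 2 by rewrite divr_gt0.
have [N1 H1] := ul _ e2; have [N2 H2] := u0 _ e2.
have := H1 _ (leq_maxl N1 N2); have := H2 _ (leq_maxr N1 N2).
set w := u _ => h2 h1; rewrite addr0 -[l](subrK w) [leRHS](splitr e).
apply: le_trans (ncD _ _) _; rewrite ncB lerD//.
by rewrite -[w]subr0.
Qed.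

End ComplexConvergence.

(** * Bounded measurable complex functions and their integrals *)

Section BoundedMeasurable.
Context {d : measure_display} {T : measurableType d} {R : realType}.
Local Notation Cx := R[i].
Local Notation nc := (@ComplexField.Normc.normc R).
Local Notation Re := (@complex.Re R).
Local Notation Im := (@complex.Im R).
Implicit Types (F G : T -> Cx) (nu : {finite_measure set T -> \bar R}).

Definition bmfun F := [/\ measurable_fun setT (fun x => Re (F x)),
  measurable_fun setT (fun x => Im (F x)) & exists K : R, forall x, nc (F x) <= K].

Lemma bmfun_cst c : bmfun (fun=> c).
Proof. by split=> //; exists (nc c). Qed.

Lemma bmfunD F G : bmfun F -> bmfun G -> bmfun (fun x => F x + G x).
Proof.
move=> [rF iF [K FK]] [rG iG [L GL]]; split.
- by under eq_fun do rewrite cReD; exact: measurable_funD.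
- by under eq_fun do rewrite cImD; exact: measurable_funD.
- by exists (K + L) => x; apply: le_trans (ncD _ _) _; exact: lerD.
Qed.

Lemma bmfunM F G : bmfun F -> bmfun G -> bmfun (fun x => F x * G x).
Proof.
move=> [rF iF [K FK]] [rG iG [L GL]]; split.
- under eq_fun do rewrite cReM.
  by apply: measurable_funB; exact: measurable_funM.
- under eq_fun do rewrite cImM.
  by apply: measurable_funD; exact: measurable_funM.
- exists (K * L) => x; rewrite ncM ler_pM ?nc_ge0//.
Qed.

Lemma bmfun_sum (I : Type) (r : seq I) (F : I -> T -> Cx) :
  (forall i, bmfun (F i)) -> bmfun (fun x => \sum_(i <- r) F i x).
Proof.
move=> H; elim: r => [|i r IH].
  by under eq_fun do rewrite big_nil; exact: bmfun_cst.
by under eq_fun do rewrite big_cons; exact: bmfunD.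
Qed.

Lemma bmfun_cvg (F_ : nat -> T -> Cx) F (K : R) : (forall k, bmfun (F_ k)) ->
  (forall k x, nc (F_ k x) <= K) -> (forall x, ccvg (F_ ^~ x) (F x)) -> bmfun F.
Proof.
move=> mF FK cF; split.
- apply: (@measurable_fun_cvg _ _ _ _ (fun k x => Re (F_ k x))) => [k|x _].
    by have [] := mF k.
  exact: ccvg_Re (cF x).
- apply: (@measurable_fun_cvg _ _ _ _ (fun k x => Im (F_ k x))) => [k|x _].
    by have [] := mF k.
  exact: ccvg_Im (cF x).
- by exists K => x; apply: ccvg_le (cF x) _.
Qed.

Definition cindic (A : set T) (x : T) : Cx := ((\1_A x : R)%:C)%C.

Lemma nc_cindic A x : nc (cindic A x) <= 1.
Proof. by rewrite nc_real indicE; case: (x \in A); rewrite ?normr0 ?normr1. Qed.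

(** The backward direction serves [circle_closure], whose measurability is read off from its
    indicator being a pointwise limit. *)
Lemma bmfun_cindicP A : measurable A <-> bmfun (cindic A).
Proof.
split=> [mA|[] /measurable_indicP//].
split; [exact: measurable_indic|exact: measurable_cst|].
by exists 1 => x; exact: nc_cindic.
Qed.

Lemma bounded_integrable nu (f : T -> R) (K : R) : measurable_fun setT f ->
  (forall x, `|f x| <= K) -> nu.-integrable setT (EFin \o f).
Proof.
move=> mf fK; apply: measurable_bounded_integrable => //.
  by rewrite -ge0_fin_numE// fin_num_measure.
exists K; split=> [|M KM x _ /=]; first exact: num_real.
exact: le_trans (fK x) (ltW KM).
Qed.

Definition crint nu F : Cx :=
  ((\int[nu]_x Re (F x)) +i* (\int[nu]_x Im (F x)))%C.

Lemma bmfun_integrable nu F : bmfun F ->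
  nu.-integrable setT (EFin \o (fun x => Re (F x))) /\
  nu.-integrable setT (EFin \o (fun x => Im (F x))).
Proof.
move=> [rF iF [K FK]]; split; apply: (@bounded_integrable _ _ K) => // x.
  exact: le_trans (Re_le_nc _) (FK x).
exact: le_trans (Im_le_nc _) (FK x).
Qed.

Lemma crintD nu F G : bmfun F -> bmfun G ->
  crint nu (fun x => F x + G x) = crint nu F + crint nu G.
Proof.
move=> /(bmfun_integrable nu)[rF iF] /(bmfun_integrable nu)[rG iG].
apply/eqP; rewrite eq_complex /crint /=; apply/andP; split; apply/eqP.
  by under eq_Rintegral do rewrite cReD; exact: RintegralD.
by under eq_Rintegral do rewrite cImD; exact: RintegralD.
Qed.

Lemma crintZ nu c F : bmfun F -> crint nu (fun x => c * F x) = c * crint nu F.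
Proof.
move=> bF; have [rF iF] := bmfun_integrable nu bF; case: bF => mr mi [K FK].
have K0 x : nc c * nc (F x) <= nc c * K by rewrite ler_wpM2l ?nc_ge0.
have hr (f : T -> R) (a : R) : measurable_fun setT f -> (forall x, `|f x| <= nc (F x)) ->
    nu.-integrable setT (EFin \o (fun x => a * f x)).
  move=> mf fF; apply: (@bounded_integrable _ _ (`|a| * K)).
    by apply: measurable_funM.
  by move=> x; rewrite normrM ler_wpM2l// (le_trans (fF x)).
have fr x : `|Re (F x)| <= nc (F x) by exact: Re_le_nc.
have fi x : `|Im (F x)| <= nc (F x) by exact: Im_le_nc.
apply/eqP; rewrite eq_complex /crint cReM cImM /=; apply/andP; split; apply/eqP.
  under eq_Rintegral do rewrite cReM.
  by rewrite RintegralB// ?RintegralZl//; exact: hr.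
under eq_Rintegral do rewrite cImM.
by rewrite RintegralD// ?RintegralZl//; exact: hr.
Qed.

Lemma Rintegral_cvg nu (f_ : nat -> T -> R) (f : T -> R) (K : R) :
  (forall k, measurable_fun setT (f_ k)) -> (forall k x, `|f_ k x| <= K) ->
  (forall x, f_ ^~ x @ \oo --> f x) ->
  (fun k => \int[nu]_x f_ k x) @ \oo --> \int[nu]_x f x.
Proof.
move=> mf fK cf.
have mlim : measurable_fun setT f by apply: (measurable_fun_cvg mf) => x _.
have [|||||fi _] := @dominated_convergence _ T R nu setT measurableT
   (fun k => EFin \o f_ k) (EFin \o f) (fun=> K%:E).
- by move=> k; apply/measurable_EFinP.
- by apply/measurable_EFinP.
- by apply: aeW => x _; apply: cvg_EFin; [near=> k|exact: cf].
- by apply: (@bounded_integrable _ (fun=> K) `|K|).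
- by apply: aeW => x k _ /=; rewrite lee_fin fK.
move=> h; apply: fine_cvg; rewrite fineK//.
by apply: integrable_fin_num.
Unshelve. all: by end_near. Qed.

Lemma crint_cvg nu (F_ : nat -> T -> Cx) F (K : R) : (forall k, bmfun (F_ k)) ->
  (forall k x, nc (F_ k x) <= K) -> (forall x, ccvg (F_ ^~ x) (F x)) ->
  ccvg (fun k => crint nu (F_ k)) (crint nu F).
Proof.
move=> bF FK cF; apply: ccvg_ReIm => /=.
  apply: (@Rintegral_cvg _ _ _ K) => [k|k x|x]; first by have [] := bF k.
    exact: le_trans (Re_le_nc _) (FK k x).
  exact: ccvg_Re (cF x).
apply: (@Rintegral_cvg _ _ _ K) => [k|k x|x]; first by have [] := bF k.
  exact: le_trans (Im_le_nc _) (FK k x).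
exact: ccvg_Im (cF x).
Qed.

Lemma crint_cindic nu A : measurable A -> crint nu (cindic A) = ((fine (nu A))%:C)%C.
Proof.
move=> mA; apply/eqP; rewrite eq_complex /crint /cindic /=; apply/andP; split; apply/eqP.
  by rewrite /Rintegral integral_indic// setIT.
by rewrite /Rintegral integral0.
Qed.

(** Integration against the complex measure sum of c_i nu_i. Keeping the positive measures separate
    lets dominated convergence and continuity from above be applied to each of them. *)
Definition cfunctional (I : finType) (nu : I -> {finite_measure set T -> \bar R})
  (c : I -> Cx) F : Cx := \sum_i c i * crint (nu i) F.

Section cfunctional.
Variables (I : finType) (nu : I -> {finite_measure set T -> \bar R}) (c : I -> Cx).
Local Notation L := (cfunctional nu c).

Lemma cfunctionalD F G : bmfun F -> bmfun G ->
  L (fun x => F x + G x) = L F + L G.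
Proof.
move=> bF bG; rewrite /cfunctional -big_split; apply: eq_bigr => i _.
by rewrite crintD// mulrDr.
Qed.

Lemma cfunctionalZ a F : bmfun F -> L (fun x => a * F x) = a * L F.
Proof.
move=> bF; rewrite /cfunctional mulr_sumr; apply: eq_bigr => i _.
by rewrite crintZ// mulrCA.
Qed.

Lemma cfunctional0 : L (fun=> 0) = 0.
Proof.
rewrite (_ : (fun=> 0) = (fun x : T => 0 * (0 : Cx))); last by apply/funext => x; rewrite mul0r.
by rewrite cfunctionalZ ?mul0r//; exact: bmfun_cst.
Qed.

Lemma cfunctional_sum (J : Type) (r : seq J) (F : J -> T -> Cx) :
  (forall j, bmfun (F j)) ->
  L (fun x => \sum_(j <- r) F j x) = \sum_(j <- r) L (F j).
Proof.
move=> bF; elim: r => [|j r IH].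
  by rewrite [RHS]big_nil -[RHS]cfunctional0; congr L; apply/funext => x; rewrite big_nil.
rewrite big_cons -IH -cfunctionalD//; last exact: bmfun_sum.
by congr L; apply/funext => x; rewrite big_cons.
Qed.

Lemma cfunctional_cvg (F_ : nat -> T -> Cx) F (K : R) : (forall k, bmfun (F_ k)) ->
  (forall k x, nc (F_ k x) <= K) -> (forall x, ccvg (F_ ^~ x) (F x)) ->
  ccvg (fun k => L (F_ k)) (L F).
Proof.
move=> bF FK cF; apply: ccvg_sum => i; apply: ccvgMl; exact: crint_cvg cF.
Qed.

Lemma nc_cfunctional_cindic A (e : R) : measurable A ->
  (forall i, fine (nu i A) <= e) -> nc (L (cindic A)) <= (\sum_i nc (c i)) * e.
Proof.
move=> mA H; apply: le_trans (nc_sum _ _ _) _; rewrite mulr_suml.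
apply: ler_sum => i _; rewrite ncM ler_wpM2l ?nc_ge0// crint_cindic//.
by rewrite ger_nc ?fine_ge0.
Qed.

End cfunctional.
End BoundedMeasurable.

(** Lagrange's identity: twice the difference of the two sides is a double sum of squares. *)
Lemma cauchy_schwarz_sum (R : realType) (I : finType) (a b : I -> R) :
  (\sum_i a i * b i) ^+ 2 <= (\sum_i a i ^+ 2) * (\sum_i b i ^+ 2).
Proof.
have : 0 <= \sum_i \sum_j (a i * b j - a j * b i) ^+ 2.
  by apply: sumr_ge0 => i _; apply: sumr_ge0 => j _; exact: sqr_ge0.
have -> : \sum_i \sum_j (a i * b j - a j * b i) ^+ 2 =
    (\sum_i \sum_j a i ^+ 2 * b j ^+ 2) + (\sum_i \sum_j b i ^+ 2 * a j ^+ 2)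
    - 2 * \sum_i \sum_j (a i * b i) * (a j * b j).
  rewrite mulr_sumr -big_split -sumrB; apply: eq_bigr => i _.
  rewrite mulr_sumr -big_split -sumrB; apply: eq_bigr => j _ /=; ring.
rewrite -!big_distrlr /= -expr2.
move: (\sum_i a i * b i) (\sum_i a i ^+ 2) (\sum_i b i ^+ 2) => x y z; nra.
Qed.

Lemma exists_natSinv_le (R : realType) (K e : R) : 0 < e ->
  exists N, forall k, (N <= k)%N -> K / k.+1%:R <= e.
Proof.
move=> e0; have [N KN] : exists N : nat, K / e <= N%:R.
  exists (Num.bound `|K / e|); apply: le_trans (ler_norm _) _; apply/ltW.
  exact: archi_boundP.
exists N => k Nk; rewrite ler_pdivrMr ?ltr0n// mulrC -ler_pdivrMr//.
by apply: le_trans KN _; rewrite ler_nat (leq_trans Nk).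
Qed.

(** * Sets of zero content and covers by arcs *)

Section CircleNullSets.
Context {R : realType}.
Local Notation Cx := R[i].
Local Notation nc := (@ComplexField.Normc.normc R).

Definition covered (s : seq (R * R)) (y : R) :=
  exists2 ab, ab \in s & ab.1 < y < ab.2.

(** Jordan content zero. Finiteness of the cover is essential: each interval contributes one pole. A
    dense Lebesgue null set such as the rationals has no such covers. *)
Definition zero_content (F : set R) := forall e : R, 0 < e ->
  exists s : seq (R * R), [/\ forall ab, ab \in s -> ab.1 < ab.2,
    \sum_(ab <- s) (ab.2 - ab.1) <= e & forall y, F y -> covered s y].

(* Intervals missing F are dropped, so that the arcs can be centred on F; points
   off the closure of F modulo 1 then stay away from all the centres. *)
Lemma arc_cover (F : set R) (s : seq (R * R)) :
  (forall ab, ab \in s -> ab.1 < ab.2) ->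
  exists s' : seq (Cx * R),
  [/\ forall cr, cr \in s' -> exists2 y, F y & cr.1 = echar y,
      forall cr, cr \in s' -> 0 < cr.2,
      \sum_(cr <- s') cr.2 <= 8 * pi * \sum_(ab <- s) (ab.2 - ab.1) &
      forall y, F y -> covered s y ->
        exists2 cr, cr \in s' & nc (echar y - cr.1) <= cr.2 / 2].
Proof.
elim: s => [|ab s IH] sab.
  by exists [::]; split => //; [rewrite !big_nil mulr0|move=> y _ []].
have [|s' [s1 s2 s3 s4]] := IH; first by move=> c cs; apply: sab; rewrite inE cs orbT.
have abs : ab.1 < ab.2 by apply: sab; rewrite inE eqxx.
have pi0 : 0 < 8 * pi :> R by rewrite mulr_gt0 ?pi_gt0.
have [[y0 Fy0 aby0]|noF] := pselect (exists2 y, F y & ab.1 < y < ab.2); last first.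
  exists s'; split => //.
    by rewrite big_cons mulrDr (le_trans s3)// lerDr mulr_ge0 ?(ltW pi0)// subr_ge0 ltW.
  move=> y Fy [c]; rewrite inE => /orP[/eqP -> yab|cs yc].
    by exfalso; apply: noF; exists y.
  by apply: s4 => //; exists c.
(* The radius is twice the Lipschitz bound [4 * pi * (ab.2 - ab.1)]: points of [F] fall within half
   of it, and the other half is reserved for points of the closure. *)
exists ((echar y0, 8 * pi * (ab.2 - ab.1)) :: s'); split.
- by move=> cr; rewrite inE => /orP[/eqP ->|/s1//]; exists y0.
- by move=> cr; rewrite inE => /orP[/eqP ->|/s2//] /=; rewrite mulr_gt0// subr_gt0.
- by rewrite !big_cons [leRHS]mulrDr lerD2l.
- move=> y Fy [c]; rewrite inE => /orP[/eqP -> yab|cs yc].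
    exists (echar y0, 8 * pi * (ab.2 - ab.1)); first by rewrite inE eqxx.
    apply: le_trans (echar_lipschitz _ _) _ => /=.
    have -> : 8 * pi * (ab.2 - ab.1) / 2 = 4 * pi * (ab.2 - ab.1) by field.
    rewrite ler_wpM2l ?mulr_ge0 ?pi_ge0//.
    move: yab aby0; case: ab {sab abs} => a b /= /andP[h1 h2] /andP[h3 h4].
    by rewrite ler_norml; apply/andP; split; lra.
  have [cr crs h] := s4 y Fy (ex_intro2 _ _ c cs yc).
  by exists cr => //; rewrite inE crs orbT.
Qed.

End CircleNullSets.

(** * Vanishing of a functional over a closed set of zero content on the circle *)

Section SingularFunctions.
Context {d : measure_display} {T : measurableType d} {R : realType}.
Local Notation Cx := R[i].
Local Notation nc := (@ComplexField.Normc.normc R).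
Variables (t : T -> R) (F : set R).

(* Preimage under t of the closure of F modulo 1. *)
Definition circle_closure : set T := [set x | forall e : R, 0 < e ->
  exists2 y, F y & nc (echar (t x) - echar y) < e].

Lemma min_radius (s : seq (Cx * R)) : (forall cr, cr \in s -> 0 < cr.2) ->
  exists2 e : R, 0 < e & forall cr, cr \in s -> e <= cr.2 / 2.
Proof.
elim: s => [|cr s IH] H; first by exists 1.
have [|e e0 He] := IH; first by move=> c cs; apply: H; rewrite inE cs orbT.
exists (Num.min e (cr.2 / 2)).
  by rewrite lt_min e0 divr_gt0// H// inE eqxx.
move=> c; rewrite inE => /orP[/eqP ->|/He ec]; first by rewrite ge_min lexx orbT.
by rewrite ge_min ec.
Qed.

Hypothesis F0 : zero_content F.

Lemma singular_polynomial_seq (k : nat) : exists p : {poly Cx},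
  [/\ forall x, nc p.[echar (t x)] <= 2,
      forall x, circle_closure x -> nc (1 - p.[echar (t x)]) <= 5 / k.+1%:R,
      forall x (e : R), 0 < e -> (forall y, F y -> e <= nc (echar (t x) - echar y)) ->
        nc p.[echar (t x)] <= (e^-1 + 1) / k.+1%:R &
      \sum_(i < size p) nc p`_i ^+ 2 <= 6 / k.+1%:R].
Proof.
pose K : R := k.+1%:R.
have K1 : 1 <= K by rewrite /K ler1n.
have K0 : 0 < K by exact: lt_le_trans K1.
have pi8 : 0 < 8 * pi :> R by rewrite mulr_gt0 ?pi_gt0.
have e0 : 0 < K ^- 2 / (8 * pi) by rewrite divr_gt0// invr_gt0 exprn_gt0.
have [s [sab ssum scov]] := F0 e0.
have [s' [s1 s2 s3 s4]] := arc_cover F sab.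
have s'sum : \sum_(cr <- s') cr.2 <= K ^- 2.
  by apply: le_trans s3 _; rewrite mulrC -ler_pdivlMr.
have Ks : K * \sum_(cr <- s') cr.2 <= K^-1.
  apply: (@le_trans _ _ (K * K ^- 2)); first by rewrite ler_wpM2l// ltW.
  by rewrite le_eqVlt; apply/orP; left; apply/eqP; field; rewrite gt_eqF.
have Ki : 0 < K^-1 <= 1 by rewrite invr_gt0 K0 invf_le1.
have Ki0 : 0 < K^-1 by case/andP: Ki.
(* M = K and error 1/K, with radii of sum at most K^-2, so that M times the sum is still at most 1/K
   although M grows. The constants are 4 + 1 = 5 near the arcs, from 1/(1 + K/4) <= 4/K, and 1 + 5 =
   6 for the coefficients. *)
have [|p [p1 p2 p3 p4]] := singular_polynomial (e := K^-1) _ s2 K0 Ki.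
  by move=> cr /s1[y _ ->]; exact: nc_echar.
exists p; split.
- move=> x; apply: le_trans (p1 _ (nc_echar _)) _.
  by case/andP: Ki => _ h; rewrite (_ : 2 = 1 + 1) ?lerD2l//; ring.
- move=> x Ex; have [e e0' He] := min_radius s2.
  have [y Fy xy] := Ex e e0'; have [cr crs ycr] := s4 y Fy (scov y Fy).
  have xcr : nc (echar (t x) - cr.1) <= cr.2.
    have -> : echar (t x) - cr.1 = (echar (t x) - echar y) + (echar y - cr.1) by ring.
    rewrite [leRHS](splitr cr.2); apply: le_trans (ncD _ _) _; apply: lerD => //.
    by apply: le_trans (ltW xy) _; exact: He.
  apply: le_trans (p2 _ _ (nc_echar _) crs xcr) _.
  have -> : 5 / K = (K / 4)^-1 + K^-1 by field; rewrite gt_eqF.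
  by rewrite lerD2r lef_pV2 ?posrE ?addr_gt0 ?divr_gt0// lerDr.
- move=> x e e0' He; apply: (le_trans (p3 _ e (nc_echar _) e0' _)).
    by move=> cr /s1[y Fy ->]; exact: He.
  by rewrite mulrDl mul1r lerD2r mulrC ler_wpM2l// invr_ge0 ltW.
- apply: le_trans p4 _; have -> : 6 / K = K^-1 + 5 * K^-1 by field; rewrite gt_eqF.
  by rewrite lerD2r.
Qed.

Variable (I : finType) (nu : I -> {finite_measure set T -> \bar R}) (c : I -> Cx).
Local Notation L := (cfunctional nu c).
Hypothesis mt : measurable_fun setT t.

Lemma bmfun_echar (s : T -> R) : measurable_fun setT s -> bmfun (fun x => echar (s x)).
Proof.
move=> ms; have m2 : measurable_fun setT (fun x => 2 * pi * s x) by exact: measurable_funM.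
split.
- apply: (measurableT_comp _ m2); apply: continuous_measurable_fun; exact: continuous_cos.
- apply: measurable_funN; apply: (measurableT_comp _ m2).
  by apply: continuous_measurable_fun; exact: continuous_sin.
- by exists 1 => x; rewrite nc_echar.
Qed.

Lemma bmfun_echarX j : bmfun (fun x => echar (t x) ^+ j).
Proof.
under eq_fun do rewrite echarX; apply: bmfun_echar; exact: measurable_funM.
Qed.

Lemma bmfun_horner (p : {poly Cx}) : bmfun (fun x => p.[echar (t x)]).
Proof.
under eq_fun do rewrite horner_coef; apply: bmfun_sum => j.
by apply: bmfunM; [exact: bmfun_cst|exact: bmfun_echarX].
Qed.

(** Cauchy-Schwarz between the coefficients of [p] and the moments of [G], whose exponents are all
    nonnegative. *)
Lemma cfunctional_horner_le (p : {poly Cx}) G (S : R) : bmfun G ->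
  (forall N, \sum_(j < N) nc (L (fun x => echar (t x) ^+ j * G x)) ^+ 2 <= S) ->
  nc (L (fun x => p.[echar (t x)] * G x)) ^+ 2 <= (\sum_(j < size p) nc p`_j ^+ 2) * S.
Proof.
move=> bG HS.
have bj j : bmfun (fun x => echar (t x) ^+ j * G x).
  by apply: bmfunM => //; exact: bmfun_echarX.
have -> : L (fun x => p.[echar (t x)] * G x) =
    \sum_(j < size p) p`_j * L (fun x => echar (t x) ^+ j * G x).
  under [RHS]eq_bigr do rewrite -cfunctionalZ//.
  rewrite -cfunctional_sum; last first.
    by move=> j; apply: bmfunM => //; exact: bmfun_cst.
  congr L; apply/funext => x; rewrite horner_coef mulr_suml.
  by apply: eq_bigr => j _; rewrite mulrA.
apply: (@le_trans _ _ ((\sum_(j < size p) nc p`_j * nc (L (fun x => echar (t x) ^+ j * G x))) ^+ 2)).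
  rewrite ler_pXn2r ?nnegrE ?nc_ge0 ?sumr_ge0// => [|j _].
    apply: le_trans (nc_sum _ _ _) _; apply: ler_sum => j _; by rewrite ncM.
  by rewrite mulr_ge0 ?nc_ge0.
apply: le_trans (cauchy_schwarz_sum _ _) _.
by rewrite ler_wpM2l ?sumr_ge0// => j _; exact: sqr_ge0.
Qed.

(** Each point either lies in [circle_closure] or keeps a positive distance from [F] modulo 1, so
    the polynomials converge everywhere to its indicator. Since [T] carries no topology, this limit
    is also what makes the set measurable. *)
Lemma singular_part_vanishes :
  measurable circle_closure /\
  forall G (S : R), bmfun G ->
    (forall N, \sum_(j < N) nc (L (fun x => echar (t x) ^+ j * G x)) ^+ 2 <= S) ->
    L (fun x => cindic circle_closure x * G x) = 0.
Proof.
have [p Hp] := choice singular_polynomial_seq.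
have cvp x : ccvg (fun k => (p k).[echar (t x)]) (cindic circle_closure x).
  have [xE|xE] := pselect (circle_closure x).
    rewrite /cindic indicE mem_set// => e e0.
    have [N HN] := exists_natSinv_le 5 e0; exists N => k /HN; apply: le_trans.
    by have [_ h _ _] := Hp k; rewrite ncB; exact: h.
  rewrite /cindic indicE memNset//.
  have /existsNP[e /not_implyP[e0 He]] := xE.
  have He' y : F y -> e <= nc (echar (t x) - echar y).
    by move=> Fy; rewrite leNgt; apply/negP => h; apply: He; exists y.
  move=> q q0; have [N HN] := exists_natSinv_le (e^-1 + 1) q0; exists N => k /HN; apply: le_trans.
  by have [_ _ h _] := Hp k; rewrite subr0; exact: h.
have bp k : bmfun (fun x => (p k).[echar (t x)]) by exact: bmfun_horner.
have p2 k x : nc (p k).[echar (t x)] <= 2 by have [] := Hp k.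
have mE : bmfun (cindic circle_closure : T -> Cx) by exact: bmfun_cvg bp p2 cvp.
split=> [|G S bG HS]; first exact/(bmfun_cindicP (R := R)).
have [_ _ [K GK]] := bG.
have c1 : ccvg (fun k => L (fun x => (p k).[echar (t x)] * G x))
    (L (fun x => cindic circle_closure x * G x)).
  apply: (@cfunctional_cvg _ _ _ _ _ _ _ _ (2 * K)) => [k|k x|x].
  - exact: bmfunM.
  - by rewrite ncM ler_pM ?nc_ge0.
  - by under eq_fun do rewrite mulrC; rewrite mulrC; exact: ccvgMl.
apply: (ccvg0_eq0 c1) => e e0.
have S0 : 0 <= S by have := HS 0%N; rewrite big_ord0.
have [N HN] := exists_natSinv_le (6 * S) (exprn_gt0 2 e0).
exists N => k /HN h; rewrite subr0 -(@ler_pXn2r _ 2) ?nnegrE ?nc_ge0 ?(ltW e0)//.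
apply: le_trans h; apply: le_trans (cfunctional_horner_le _ bG HS) _.
by rewrite mulrAC ler_wpM2r//; have [] := Hp k.
Qed.

End SingularFunctions.

(** * From Lebesgue null sets to sets of zero content, up to small measure *)

Section NullSets.
Context {R : realType}.

(** Lebesgue outer measure is an infimum over covers by open intervals. The filter in the sum
    discards reversed endpoints: such an interval is empty, but its difference of endpoints would
    count negatively. *)
Lemma negligible_interval_cover (N : set R) (e : R) : 0 < e ->
  (@lebesgue_measure R).-negligible N ->
  exists ab : nat -> R * R,
    (forall y, N y -> exists j, (ab j).1 < y < (ab j).2) /\
    forall n, \sum_(j < n | (ab j).1 < (ab j).2) ((ab j).2 - (ab j).1) <= e.
Proof.
move=> e0 /negligible_outer_measure N0.
have H : (wlength idfun)^*%mu N \is a fin_num by rewrite N0.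
have [I_ [IN NI] Ie] : exists2 I_, open_itv_cover N I_ &
    (\sum_(0 <= k <oo) wlength idfun (I_ k) <= e%:E)%E.
  move: H; rewrite outer_measure_open_itv_cover.
  move=> /(lb_ereal_inf_adherent e0)[_/= [I_ NI <-]].
  rewrite -outer_measure_open_itv_cover N0 add0e => /ltW h.
  by exists I_.
have [ab Hab] := choice IN.
exists ab; split=> [y Ny|n].
  have [j _] := NI y Ny; rewrite Hab /= in_itv/= => yj; by exists j.
rewrite -lee_fin; apply: le_trans Ie.
have IE j : wlength idfun (I_ j) = (if (ab j).1 < (ab j).2 then (ab j).2 - (ab j).1 else 0)%:E.
  by rewrite Hab wlength_itv/= lte_fin; case: ifP.
apply: le_trans (_ : (\sum_(0 <= k < n) wlength idfun (I_ k) <= _)%E).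
  rewrite big_mkord; under [leRHS]eq_bigr do rewrite IE.
  by rewrite sumEFin lee_fin big_mkcond.
apply: nneseries_lim_ge => j _ _; rewrite IE lee_fin; case: ifP => // h.
by rewrite subr_ge0 ltW.
Qed.

Context {d : measure_display} {T : measurableType d}.
Variables (I : finType) (nu : I -> {finite_measure set T -> \bar R}).
Variables (t : T -> R) (A : set T).
Hypotheses (mt : measurable_fun setT t) (mA : measurable A).

Lemma measurable_preimage_itv (s : R * R) :
  measurable [set x | s.1 < t x < s.2].
Proof.
rewrite (_ : [set x | _] = setT `&` t @^-1` `]s.1, s.2[%classic).
  by apply: mt => //; exact: measurable_itv.
by rewrite setTI; apply/seteqP; split=> x /=; rewrite in_itv.
Qed.

(** The uncovered parts decrease to the empty set, so each finite measure of them tends to 0; as [I]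
    is finite, one [n] serves all the measures. *)
Lemma truncate_cover (ab : nat -> R * R) (e : R) : 0 < e ->
  (forall x, A x -> exists j, (ab j).1 < t x < (ab j).2) ->
  exists n, forall i, (nu i (A `\` [set x | exists2 j, (j < n)%N & ((ab j).1 < t x < (ab j).2)%R])
     <= e%:E)%E.
Proof.
move=> e0 HA.
pose B n := A `\` [set x | exists2 j, (j < n)%N & (ab j).1 < t x < (ab j).2].
have mB n : measurable (B n).
  apply: measurableD => //.
  rewrite (_ : [set x | _] = \bigcup_(j in [set j | (j < n)%N]) [set x | (ab j).1 < t x < (ab j).2]).
    by apply: bigcup_measurable => j _; exact: measurable_preimage_itv.
  by apply/seteqP; split=> x [j ? ?]; exists j.
have B0 : \bigcap_n B n = set0.
  rewrite -subset0 => x Bx; have [Ax _] := Bx 0%N Logic.I.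
  have [j xj] := HA x Ax; have [_ ] := Bx j.+1 Logic.I; apply; by exists j.
have cv i : (nu i \o B) n @[n --> \oo] --> 0%E.
  rewrite -(measure0 (nu i)) -B0; apply: nonincreasing_cvg_mu => //.
  - by rewrite -ge0_fin_numE// fin_num_measure.
  - by rewrite B0; exact: measurable0.
  - move=> n m nm; apply/subsetPset => x [Ax Bx]; split=> // -[j jn xj].
    by apply: Bx; exists j => //; exact: leq_trans nm.
have : \forall n \near \oo, forall i, (nu i (B n) <= e%:E)%E.
  apply: filter_forall => i.
  have /fine_cvgP[_ /cvgrPdist_le /(_ _ e0)] := cv i; apply: filterS => n /=.
  rewrite sub0r normrN ger0_norm ?fine_ge0// => h.
  by rewrite -(@fineK _ (nu i (B n))) ?lee_fin// fin_num_measure.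
by move=> [n _ /(_ n (leqnn n)) h]; exists n.
Qed.

(* F is the intersection over k of finite truncations of covers of N by
   intervals of total length at most 1/(k+1). *)
Lemma zero_content_exhaustion (N : set R) (e : R) : 0 < e ->
  (@lebesgue_measure R).-negligible N -> (forall x, A x -> N (t x)) ->
  exists F : set R, [/\ zero_content F, measurable (circle_closure t F : set T) &
    forall i, fine (nu i (A `\` circle_closure t F)) <= e].
Proof.
move=> e0 N0 AN.
have k1 k : 0 < k.+1%:R^-1 :> R by rewrite invr_gt0.
have [ab Hab] := choice (fun k => negligible_interval_cover (k1 k) N0).
pose V k n := [set x | exists2 j, (j < n)%N & (ab k j).1 < t x < (ab k j).2].
have e1 k : 0 < e / (2 ^ k.+1)%:R by rewrite divr_gt0// ltr0n expn_gt0.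
have Ak k x : A x -> exists j, (ab k j).1 < t x < (ab k j).2.
  by move=> Ax; have [H _] := Hab k; apply: H; exact: AN.
have [n Hn] := choice (fun k => truncate_cover (e1 k) (Ak k)).
pose F := [set y | forall k, exists2 j, (j < n k)%N & (ab k j).1 < y < (ab k j).2].
have F0 : zero_content F.
  move=> q q0; have [k Hk] := exists_natSinv_le 1 q0.
  exists [seq ab k j | j <- [seq j <- iota 0 (n k) | (ab k j).1 < (ab k j).2]]; split.
  - by move=> c /mapP[j]; rewrite mem_filter => /andP[h _] ->.
  - rewrite big_map big_filter; have [_ /(_ (n k)) h] := Hab k.
    apply: le_trans (Hk k (leqnn k)); rewrite div1r; apply: le_trans h.
    have -> : iota 0 (n k) = index_iota 0 (n k) by rewrite /index_iota subn0.
    by rewrite big_mkord.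
  - move=> y /(_ k)[j jn yj]; exists (ab k j) => //; apply/mapP; exists j => //.
    have /andP[h1 h2] := yj; by rewrite mem_filter mem_iota (lt_trans h1 h2).
have mE : measurable (circle_closure t F : set T).
  (* Only the measurability half is wanted here, hence the dummy zero coefficients. *)
  by have [] := singular_part_vanishes F0 nu (fun=> 0) mt.
have mV k : measurable (A `\` V k (n k)).
  apply: measurableD => //.
  rewrite (_ : V _ _ = \bigcup_(j in [set j | (j < n k)%N]) [set x | (ab k j).1 < t x < (ab k j).2]).
    by apply: bigcup_measurable => j _; exact: measurable_preimage_itv.
  by apply/seteqP; split=> x [j ? ?]; exists j.
exists F; split => // i.
have mAE : measurable (A `\` circle_closure t F) by exact: measurableD.
rewrite -lee_fin fineK ?fin_num_measure//.
apply: (@le_trans _ _ (\sum_(0 <= k <oo) nu i (A `\` V k (n k)))%E).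
  apply: measure_sigma_subadditive => // x [Ax xE].
  have : ~ F (t x).
    by move=> Fx; apply: xE => q q0; exists (t x) => //; rewrite subrr nc0.
  by move=> /existsNP[k Hk]; exists k => //; split.
apply: (@le_trans _ _ (\sum_(0 <= k <oo) (e / (2 ^ k.+1)%:R)%:E)%E).
  by apply: lee_nneseries => // k _; exact: Hn.
by apply: epsilon_trick0; exact: ltW.
Qed.

End NullSets.

(** * The sign function as a limit of polynomials, and of signs of sines *)

Section SignIteration.
Context {R : realType}.
Implicit Types (v : R).

(* v |-> (3v - v^3)/2 maps [-1,1] to itself and pushes every v != 0 to sg v. *)
Definition sign_step v : R := (3 * v - v ^+ 3) / 2.

Lemma sign_stepN v : sign_step (- v) = - sign_step v.
Proof. by rewrite /sign_step; field. Qed.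

Lemma iter_sign_stepN k v : iter k sign_step (- v) = - iter k sign_step v.
Proof. by elim: k => //= k ->; rewrite sign_stepN. Qed.

(** The distance to 1 is multiplied at each step by (1 - w)(2 + w)/2 <= 1 - w/2, and the iterate w
    never drops below its starting value v. *)
Lemma iter_sign_step_bound k v : 0 < v <= 1 ->
  v <= iter k sign_step v <= 1 /\ 1 - iter k sign_step v <= (1 - v / 2) ^+ k.
Proof.
move=> /andP[v0 v1]; elim: k => [|k [/andP[h1 h2] h3]].
  by rewrite expr0 lexx v1 lerBlDr lerDl ltW.
rewrite iterS; move: (iter k _ v) h1 h2 h3 => w h1 h2 h3.
have E : 1 - sign_step w = (1 - w) * ((1 - w) * (2 + w) / 2) by rewrite /sign_step; field.
have w0 : 0 < w by exact: lt_le_trans h1.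
split.
  rewrite /sign_step; apply/andP; split.
    by rewrite ler_pdivlMr//; nra.
  rewrite -subr_ge0 E mulr_ge0 ?subr_ge0// divr_ge0// mulr_ge0 ?subr_ge0//; lra.
rewrite E exprS mulrC; apply: ler_pM => //; rewrite ?subr_ge0//.
  by rewrite divr_ge0// mulr_ge0 ?subr_ge0//; lra.
by rewrite ler_pdivrMr//; nra.
Qed.

Lemma iter_sign_step_cvg v : -1 <= v <= 1 ->
  forall e, 0 < e -> exists N, forall k, (N <= k)%N ->
    `|iter k sign_step v - Num.sg v| <= e.
Proof.
suff H (u : R) : 0 < u <= 1 -> forall e, 0 < e -> exists N, forall k, (N <= k)%N ->
    `|iter k sign_step u - Num.sg u| <= e.
  move=> /andP[v1 v2] e e0; case: (ltgtP v 0) => [v0|v0|->].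
  - have [|N HN] := H (- v) _ e e0; first by apply/andP; split; lra.
    exists N => k /HN; rewrite iter_sign_stepN sgrN -opprD normrN; exact.
  - by apply: H => //; rewrite v0.
  - exists 0%N => k _; rewrite sgr0 subr0.
    have -> : iter k sign_step (0 : R) = 0.
      by elim: k => //= k ->; rewrite /sign_step; field.
    by rewrite normr0 ltW.
move=> /andP[u0 u1] e e0.
have : `|1 - u / 2| < 1 by rewrite ger0_norm; lra.
move=> /cvg_expr/cvgrPdist_le/(_ _ e0)[N _ HN]; exists N => k Nk.
have [|/andP[_ h2] h3] := @iter_sign_step_bound k u; first by rewrite u0.
rewrite gtr0_sg// distrC ger0_norm ?subr_ge0//.
apply: le_trans h3 _; have := HN k Nk; rewrite sub0r normrN; apply: le_trans.
exact: ler_norm.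
Qed.

Lemma iter_sign_step_le1 k v : -1 <= v <= 1 -> `|iter k sign_step v| <= 1.
Proof.
move=> /andP[v1 v2]; have [v0|v0|->] := ltgtP v 0.
- have [|/andP[h1 h2] _] := @iter_sign_step_bound k (- v); first by apply/andP; split; lra.
  by rewrite -normrN -iter_sign_stepN ger0_norm//; lra.
- have [|/andP[h1 h2] _] := @iter_sign_step_bound k v; first by rewrite v0.
  by rewrite ger0_norm//; lra.
- have -> : iter k sign_step (0 : R) = 0.
    by elim: k => //= k ->; rewrite /sign_step; field.
  by rewrite normr0.
Qed.

(** Once |s|/(k+1) <= 1/4 the angle lies in [-pi/2, pi/2], where sine has the sign of its argument.
    This is how the non-periodic sign of a coordinate is reached from periodic functions. *)
Lemma sg_sin_cvg (s : R) : exists N, forall k, (N <= k)%N ->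
  Num.sg (sin (2 * pi * (s / k.+1%:R))) = Num.sg s.
Proof.
have e0 : 0 < 4^-1 :> R by rewrite invr_gt0.
have [N HN] := exists_natSinv_le `|s| e0.
exists N => k /HN h; have k0 : 0 < k.+1%:R :> R by rewrite ltr0n.
have H (u : R) : 0 < u -> `|u| / k.+1%:R <= 4^-1 -> 0 < sin (2 * pi * (u / k.+1%:R)).
  move=> u0; rewrite gtr0_norm// => uk; apply: sin_gt0_pi.
  have p0 := pi_gt0 R; have u1 : 0 < u / k.+1%:R by rewrite divr_gt0.
  apply/andP; split; first by rewrite !mulr_gt0.
  by move: (u / _) u1 uk => w w0 w1; nra.
have [s0|s0|->] := ltgtP s 0.
- have := H (- s); rewrite oppr_gt0 normrN => /(_ s0 h).
  rewrite mulNr mulrN sinN oppr_gt0 => hs.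
  by rewrite !ltr0_sg.
- by rewrite !gtr0_sg// H.
- by rewrite mul0r mulr0 sin0.
Qed.

End SignIteration.

(** * Multipliers: characters, sines and signs of coordinates *)

Section EuclideanMultipliers.
Variables (R : realType) (n : nat).
Local Notation Cx := R[i].
Local Notation nc := (@ComplexField.Normc.normc R).
Local Notation T := (Rn R n).
Variable (I : finType) (nu : I -> {finite_measure set T -> \bar R}) (c : I -> Cx).
Local Notation L := (cfunctional nu c).

Lemma measurable_coord (i : 'I_n) : measurable_fun setT (fun x : T => (x : 'rV[R]_n) 0 i).
Proof.
apply: (measurability (@RGenOpens.G R)); first exact: RGenOpens.measurableE.
move=> _ [_ [a [b ->]] <-]; rewrite setTI; apply: sub_sigma_algebra.
have /continuousP := @coord_continuous R 1 n 0 i; apply; exact: interval_open.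
Qed.

Lemma measurable_dotv (xi : 'rV[R]_n) : measurable_fun setT (fun x : T => dotv xi x).
Proof.
by apply: measurable_sum => i; apply: measurable_funM => //; exact: measurable_coord.
Qed.

Definition chi (xi : 'rV[R]_n) (x : T) : Cx := echar (dotv xi x).

Lemma bmfun_chi xi : bmfun (chi xi).
Proof. by apply: bmfun_echar; exact: measurable_dotv. Qed.

Lemma dotvDl (u v x : 'rV[R]_n) : dotv (u + v) x = dotv u x + dotv v x.
Proof. by rewrite /dotv -big_split; apply: eq_bigr => i _; rewrite mxE mulrDl. Qed.

Lemma dotvZl a (u x : 'rV[R]_n) : dotv (a *: u) x = a * dotv u x.
Proof. by rewrite /dotv mulr_sumr; apply: eq_bigr => i _; rewrite mxE mulrA. Qed.

Lemma dotv_delta i (x : 'rV[R]_n) : dotv (delta_mx 0 i) x = x 0 i.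
Proof.
rewrite /dotv (bigD1 i)//= big1 ?addr0 => [|j ji]; rewrite mxE eqxx /=.
  by rewrite eqxx mul1r.
by rewrite (negPf ji) mul0r.
Qed.

Lemma chiD u v x : chi (u + v) x = chi u x * chi v x.
Proof. by rewrite /chi dotvDl echarD. Qed.

Lemma chi0 x : chi 0 x = 1.
Proof.
by rewrite /chi (_ : dotv 0 x = 0) ?echar0// /dotv big1// => i _; rewrite mxE mul0r.
Qed.

(* [annihilated F] says that the Fourier transform of F nu vanishes. Multipliers
   preserving this form an algebra containing the characters and closed under
   bounded pointwise limits, hence contain all Borel indicators: this is the
   uniqueness theorem for Fourier transforms. *)
Definition annihilated (F : T -> Cx) := forall xi, L (fun x => F x * chi xi x) = 0.

Definition multiplier (m : T -> Cx) := bmfun m /\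
  forall F, bmfun F -> annihilated F -> annihilated (fun x => m x * F x).

Lemma multiplier_ext m1 m2 : m1 =1 m2 -> multiplier m1 -> multiplier m2.
Proof. by move=> /funext ->. Qed.

Lemma multiplier_chi xi : multiplier (chi xi).
Proof.
split=> [|F bF VF eta]; first exact: bmfun_chi.
by rewrite -(VF (xi + eta)); congr L; apply/funext => x; rewrite chiD; ring.
Qed.

Lemma multiplierZ a m : multiplier m -> multiplier (fun x => a * m x).
Proof.
move=> [bm Hm]; split=> [|F bF VF xi]; first by apply: bmfunM => //; exact: bmfun_cst.
transitivity (a * L (fun x => m x * F x * chi xi x)); last by rewrite Hm// mulr0.
rewrite -cfunctionalZ; last by apply: bmfunM; [exact: bmfunM|exact: bmfun_chi].
by congr L; apply/funext => x; ring.
Qed.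

Lemma multiplierD m1 m2 : multiplier m1 -> multiplier m2 ->
  multiplier (fun x => m1 x + m2 x).
Proof.
move=> [b1 H1] [b2 H2]; split=> [|F bF VF xi]; first exact: bmfunD.
transitivity (L (fun x => m1 x * F x * chi xi x) + L (fun x => m2 x * F x * chi xi x)).
  rewrite -cfunctionalD; last 2 first.
  - by apply: bmfunM; [exact: bmfunM|exact: bmfun_chi].
  - by apply: bmfunM; [exact: bmfunM|exact: bmfun_chi].
  by congr L; apply/funext => x; ring.
by rewrite H1// H2// addr0.
Qed.

Lemma multiplierM m1 m2 : multiplier m1 -> multiplier m2 ->
  multiplier (fun x => m1 x * m2 x).
Proof.
move=> [b1 H1] [b2 H2]; split=> [|F bF VF xi]; first exact: bmfunM.
rewrite -(H1 _ (bmfunM b2 bF) (H2 _ bF VF) xi).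
by congr L; apply/funext => x; rewrite mulrA.
Qed.

Lemma multiplier_cst a : multiplier (fun=> a).
Proof.
apply: (multiplier_ext (m1 := fun x => a * chi 0 x)).
  by move=> x; rewrite chi0 mulr1.
by apply: multiplierZ; exact: multiplier_chi.
Qed.

Lemma multiplier_cvg (m_ : nat -> T -> Cx) m (K : R) : (forall k, multiplier (m_ k)) ->
  (forall k x, nc (m_ k x) <= K) -> (forall x, ccvg (m_ ^~ x) (m x)) -> multiplier m.
Proof.
move=> Hm mK cm; have bm k : bmfun (m_ k) by have [] := Hm k.
split=> [|F bF VF xi]; first exact: bmfun_cvg bm mK cm.
have [_ _ [K' FK]] := bF.
apply: (@ccvg0_eq0 _ (fun k => L (fun x => m_ k x * F x * chi xi x))).
  apply: (@cfunctional_cvg _ _ _ _ _ _ _ _ (K * K')) => [k|k x|x].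
  - by apply: bmfunM; [exact: bmfunM|exact: bmfun_chi].
  - by rewrite !ncM nc_echar mulr1 ler_pM ?nc_ge0.
  - rewrite (_ : (fun k => _) = fun k => (F x * chi xi x) * m_ k x); last first.
      by apply/funext => k; ring.
    by rewrite (_ : m x * F x * _ = (F x * chi xi x) * m x); [exact: ccvgMl|ring].
under eq_fun do rewrite (proj2 (Hm _) F bF VF xi).
exact: ccvg_cst.
Qed.

(** The iterates of [sign_step] are polynomials in [v], bounded by 1, so the algebra structure and
    bounded limits apply. *)
Lemma multiplier_sg (v : T -> R) : (forall x, -1 <= v x <= 1) ->
  multiplier (fun x => ((v x)%:C)%C) -> multiplier (fun x => ((Num.sg (v x))%:C)%C).
Proof.
move=> v1 Hv.
apply: (@multiplier_cvg (fun k x => ((iter k sign_step (v x))%:C)%C) _ 1) => [k|k x|x].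
- elim: k => [//|k IH].
  apply: (multiplier_ext (m1 := fun x => (((3 / 2 : R)%:C)%C * ((iter k sign_step (v x))%:C)%C)
    + ((- (1 / 2) : R)%:C)%C * (((iter k sign_step (v x))%:C)%C *
        (((iter k sign_step (v x))%:C)%C * ((iter k sign_step (v x))%:C)%C)))).
    by move=> x; rewrite -!rmorphM -rmorphD; congr (_%:C)%C; rewrite /= /sign_step; field.
  apply: multiplierD; first exact: multiplierZ.
  by apply: multiplierZ; apply: multiplierM => //; exact: multiplierM.
- by rewrite nc_real iter_sign_step_le1.
- move=> e e0; have [N HN] := iter_sign_step_cvg (v1 x) e0; exists N => k /HN.
  by rewrite -rmorphB nc_real.
Qed.

Lemma multiplier_sin (xi : 'rV[R]_n) (a : R) :
  multiplier (fun x => ((sin (2 * pi * (dotv xi x - a)))%:C)%C).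
Proof.
(* Euler's formula for sine; as [echar t] is exp(-2 pi i t), the exponential with positive sign
   comes from [chi (- xi)]. *)
apply: (multiplier_ext (m1 := fun x =>
  (2 * 'i)^-1%C * (echar a * chi (- xi) x + (-1) * (echar (- a) * chi xi x)))).
  move=> x; rewrite /chi.
  have -> : dotv (- xi) x = - dotv xi x by rewrite -scaleN1r dotvZl mulN1r.
  rewrite -!echarD; have -> : a - dotv xi x = - (dotv xi x - a) by ring.
  rewrite [- a + _]addrC echarN /echar.
  have i0 : (2 * 'i : Cx)%C != 0 by rewrite mulf_neq0 ?pnatr_eq0// eq_complex /= oner_eq0 andbF.
  apply: (mulfI i0); rewrite mulrA divff// mul1r.
  by apply/eqP; rewrite eq_complex /=; apply/andP; split; apply/eqP; ring.
apply: multiplierZ; apply: multiplierD; first by apply: multiplierZ; exact: multiplier_chi.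
by apply: multiplierZ; apply: multiplierZ; exact: multiplier_chi.
Qed.

Lemma multiplier_sg_coord (i : 'I_n) (a : R) :
  multiplier (fun x => ((Num.sg ((x : 'rV[R]_n) 0 i - a))%:C)%C).
Proof.
apply: (@multiplier_cvg (fun k x =>
  ((Num.sg (sin (2 * pi * (((x : 'rV[R]_n) 0 i - a) / k.+1%:R))))%:C)%C) _ 1) => [k|k x|x].
- apply: multiplier_sg => [x|]; first by rewrite sin_geN1 sin_le1.
  apply: multiplier_ext (multiplier_sin (k.+1%:R^-1 *: delta_mx 0 i) (a / k.+1%:R)) => x.
  by rewrite dotvZl dotv_delta; congr ((sin _)%:C)%C; rewrite mulrBl [X in 2 * pi * (X - _)]mulrC.
- by rewrite nc_real normr_sg; case: (_ != 0).
- move=> e e0; have [N HN] := sg_sin_cvg ((x : 'rV[R]_n) 0 i - a); exists N => k /HN ->.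
  by rewrite subrr nc0 ltW.
Qed.

End EuclideanMultipliers.

(** * Indicators of Borel sets are multipliers *)

Section BorelMultipliers.
Variables (R : realType) (n : nat).
Local Notation Cx := R[i].
Local Notation nc := (@ComplexField.Normc.normc R).
Local Notation T := (Rn R n).
Variable (I : finType) (nu : I -> {finite_measure set T -> \bar R}) (c : I -> Cx).
Local Notation L := (cfunctional nu c).

Definition multiplier_set (A : set T) := multiplier nu c (cindic A).

Lemma multiplier_setC A : multiplier_set A -> multiplier_set (~` A).
Proof.
move=> mA; apply: (multiplier_ext (m1 := fun x => 1 + (-1) * cindic A x)).
  move=> x; rewrite /cindic indicC indicE; case: (x \in A) => /=.
    by rewrite mulr1 subrr.
  by rewrite mulr0 addr0.
by apply: multiplierD; [exact: multiplier_cst|exact: multiplierZ].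
Qed.

Lemma multiplier_setI A B : multiplier_set A -> multiplier_set B -> multiplier_set (A `&` B).
Proof.
move=> mA mB; apply: (multiplier_ext (m1 := fun x => cindic A x * cindic B x)).
  by move=> x; rewrite /cindic indicI rmorphM.
exact: multiplierM.
Qed.

Lemma multiplier_setT : multiplier_set setT.
Proof.
apply: (multiplier_ext (m1 := fun=> 1)); last exact: multiplier_cst.
by move=> x; rewrite /cindic indicT.
Qed.

Lemma multiplier_set0 : multiplier_set set0.
Proof. by rewrite -setCT; apply: multiplier_setC; exact: multiplier_setT. Qed.

Lemma multiplier_setU A B : multiplier_set A -> multiplier_set B -> multiplier_set (A `|` B).
Proof.
move=> mA mB; rewrite -[A `|` B]setCK setCU.
by apply: multiplier_setC; apply: multiplier_setI; exact: multiplier_setC.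
Qed.

Lemma multiplier_bigcup (A : nat -> set T) : (forall k, multiplier_set (A k)) ->
  multiplier_set (\bigcup_k A k).
Proof.
move=> mA; pose B k := \big[setU/set0]_(j < k) A j.
have mB k : multiplier_set (B k).
  rewrite /B; elim/big_ind : _ => //; first exact: multiplier_set0.
  exact: multiplier_setU.
apply: (multiplier_cvg (m_ := fun k => cindic (B k)) (K := 1)) => // [k x|x].
  exact: nc_cindic.
have [[j _ Ax]|nA] := pselect ((\bigcup_k A k) x).
  move=> e e0; exists j.+1 => k jk; rewrite /cindic !indicE !mem_set//.
  - by rewrite subrr nc0 ltW.
  - by exists j.
  - exact: (@bigsetU_sup _ j k A jk).
move=> e e0; exists 0%N => k _; rewrite /cindic !indicE !memNset ?subrr ?nc0 ?ltW//.
by move=> Bx; apply: nA; exact: bigsetU_bigcup Bx.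
Qed.

Lemma multiplier_halfspace (i : 'I_n) (a : R) :
  multiplier_set [set x : T | a < (x : 'rV[R]_n) 0 i] /\
  multiplier_set [set x : T | (x : 'rV[R]_n) 0 i < a].
Proof.
have msg := multiplier_sg_coord nu c i a.
(* For s = 1 or -1 and a sign g in {-1, 0, 1}, the value (g^2 + s g)/2 is 1 if g = s and 0
   otherwise. *)
have H (s : R) : s ^+ 2 = 1 -> multiplier nu c (fun x =>
    (((Num.sg ((x : 'rV[R]_n) 0 i - a) ^+ 2 + s * Num.sg ((x : 'rV[R]_n) 0 i - a)) / 2)%:C)%C).
  move=> _; apply: (multiplier_ext (m1 := fun x : T =>
    ((2^-1 : R)%:C)%C *
      (((Num.sg ((x : 'rV[R]_n) 0 i - a))%:C)%C * ((Num.sg ((x : 'rV[R]_n) 0 i - a))%:C)%C)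
    + ((s / 2)%:C)%C * ((Num.sg ((x : 'rV[R]_n) 0 i - a))%:C)%C)).
    by move=> x; rewrite -!rmorphM -rmorphD; congr (_%:C)%C; rewrite /=; field.
  apply: multiplierD; last exact: multiplierZ.
  by apply: multiplierZ; exact: multiplierM.
split.
- apply: multiplier_ext (H 1 (expr1n _ _)) => x; rewrite /cindic indicE; congr (_%:C)%C.
  have [ax|xa|ax] := ltgtP a ((x : 'rV[R]_n) 0 i).
  + by rewrite mem_set//= gtr0_sg ?subr_gt0//; field.
  + by rewrite memNset /= ?ltr0_sg ?subr_lt0//; [field|rewrite lt_gtF].
  + by rewrite memNset /= -ax ?subrr ?sgr0; [field|rewrite ltxx].
- have N1 : (-1 : R) ^+ 2 = 1 by rewrite sqrrN expr1n.
  apply: multiplier_ext (H (-1) N1) => x; rewrite /cindic indicE; congr (_%:C)%C.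
  have [ax|xa|ax] := ltgtP a ((x : 'rV[R]_n) 0 i).
  + by rewrite memNset /= ?gtr0_sg ?subr_gt0//; [field|rewrite lt_gtF].
  + by rewrite mem_set//= ltr0_sg ?subr_lt0//; field.
  + by rewrite memNset /= -ax ?subrr ?sgr0; [field|rewrite ltxx].
Qed.

(** Cubes with rational centre and half-side 1/(k+1): a countable base of the topology, so that
    every open set is a countable union of boxes. *)
Definition rat_box (q : 'rV[rat]_n) (k : nat) : set 'rV[R]_n :=
  [set x | forall i, `|x 0 i - ratr (q 0 i)| < k.+1%:R^-1].

Lemma multiplier_rat_box q k : multiplier_set (rat_box q k).
Proof.
pose h (i : 'I_n) : set T :=
  [set x | ratr (q 0 i) - k.+1%:R^-1 < (x : 'rV[R]_n) 0 i] `&`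
  [set x | (x : 'rV[R]_n) 0 i < ratr (q 0 i) + k.+1%:R^-1].
have -> : rat_box q k = \big[setI/setT]_i h i.
  rewrite -bigcap_seq; apply/seteqP; split=> x /= Hx i.
    move=> _; have := Hx i; rewrite ltr_norml => /andP[h1 h2].
    suff H (a b e : R) : - e < a - b -> a - b < e -> b - e < a /\ a < b + e by exact: H h1 h2.
    by move=> ? ?; split; lra.
  have [|/= h1 h2] := Hx i; first by rewrite /= mem_index_enum.
  suff H (a b e : R) : b - e < a -> a < b + e -> `|a - b| < e by exact: H h1 h2.
  by move=> ? ?; rewrite ltr_norml; apply/andP; split; lra.
elim/big_ind : _ => [||i _]; [exact: multiplier_setT|exact: multiplier_setI|].
by apply: multiplier_setI; [exact: (multiplier_halfspace i _).1|exact: (multiplier_halfspace i _).2].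
Qed.

Lemma multiplier_open (U : set 'rV[R]_n) : open U -> multiplier_set U.
Proof.
move=> oU.
(* [unpickle] enumerates the pairs (q, k); invalid codes and boxes not contained in [U] contribute
   the empty set. *)
pose A (j : nat) : set T := if unpickle j is Some (q, k) then
  (if pselect (rat_box q k `<=` U) then rat_box q k else set0) else set0.
have -> : U = \bigcup_j A j.
  apply/seteqP; split=> x; last first.
    move=> [j _]; rewrite /A; case: unpickle => [[q k]|//].
    by case: pselect => //= H; exact: H.
  move=> Ux; have /nbhs_ballP[e /= e0 xU] : nbhs x U by exact: open_nbhs_nbhs.
  (* The constant is 2 because a box containing [x] has side [2 / k.+1%:R] and must fit in the ball
     of radius [e] about [x]. *)
  have [k0 Hk] := exists_natSinv_le 2 e0; pose k := k0.
  have ke : 2 / k.+1%:R <= e by exact: Hk.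
  have Hq i : exists q : rat, `|x 0 i - ratr q| < k.+1%:R^-1.
    have k1 : 0 < k.+1%:R^-1 :> R by rewrite invr_gt0.
    have [|q] := @rat_in_itvoo R (x 0 i - k.+1%:R^-1) (x 0 i + k.+1%:R^-1).
      by rewrite ltrD2l gtrN.
    rewrite in_itv /= => /andP[q1 q2]; exists q.
    suff H (a b e1 : R) : a - e1 < b -> b < a + e1 -> `|a - b| < e1 by exact: H q1 q2.
    by move=> ? ?; rewrite ltr_norml; apply/andP; split; lra.
  have [q0 Hq0] := choice Hq; pose q := \row_i q0 i.
  have xq : rat_box q k x by move=> i; rewrite /= mxE.
  exists (pickle (q, k)) => //; rewrite /A pickleK.
  case: pselect => //= nH; exfalso; apply: nH => y yq; apply: xU; split => // i j.
  rewrite ord1 /ball /= /ball_; apply: lt_le_trans ke.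
  have -> : x 0 j - y 0 j = (x 0 j - ratr (q 0 j)) - (y 0 j - ratr (q 0 j)) by ring.
  apply: le_lt_trans (ler_normB _ _) _; rewrite mulr_natl mulr2n.
  by apply: ltrD; [exact: xq|exact: yq].
apply: multiplier_bigcup => j; rewrite /A; case: unpickle => [[q k]|]; last exact: multiplier_set0.
by case: pselect => ?; [exact: multiplier_rat_box|exact: multiplier_set0].
Qed.

Lemma multiplier_measurable (A : set T) : measurable A -> multiplier_set A.
Proof.
have sa : sigma_algebra setT multiplier_set.
  split=> [|B mB|]; [exact: multiplier_set0| |exact: multiplier_bigcup].
  by rewrite setTD; exact: multiplier_setC.
exact: (smallest_sub sa multiplier_open).
Qed.

End BorelMultipliers.

(** * Vanishing on sets of null projection; deviation of directions *)

Section DirectionalDecay.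
Variables (R : realType) (n : nat).
Local Notation Cx := R[i].
Local Notation nc := (@ComplexField.Normc.normc R).
Local Notation T := (Rn R n).
Variable (I : finType) (nu : I -> {finite_measure set T -> \bar R}) (c : I -> Cx).
Local Notation L := (cfunctional nu c).

Lemma cfunctional_null_projection (u : 'rV[R]_n) (A : set T) :
  (forall xi, exists S : R, forall N : nat,
     \sum_(j < N) nc (L (chi (xi + j%:R *: u))) ^+ 2 <= S) ->
  measurable A ->
  (@lebesgue_measure R).-negligible [set dotv u x | x in A] ->
  L (cindic A) = 0.
Proof.
move=> decay mA nA; pose t (x : T) := dotv u x.
have mt : measurable_fun setT t by exact: measurable_dotv.
apply: nc0_eq0; apply/eqP; rewrite eq_le nc_ge0 andbT.
apply/ler_addgt0Pl => e e0; rewrite addr0.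
pose C0 := \sum_i nc (c i); have C00 : 0 <= C0 by apply: sumr_ge0 => i _; exact: nc_ge0.
(* [C0 + 1] avoids a division by zero when all coefficients vanish. *)
have e'0 : 0 < e / (C0 + 1) by rewrite divr_gt0// ltr_wpDl.
have At x : A x -> [set dotv u x | x in A] (t x) by move=> Ax; exists x.
have [F [F0 mE AE]] := zero_content_exhaustion nu mt mA e'0 nA At.
set E := circle_closure t F in mE AE.
have [_ sing] := singular_part_vanishes F0 nu c mt.
have annE : annihilated nu c (cindic E).
  move=> xi; have [S HS] := decay xi; apply: (sing (chi xi) S) => [|N].
    exact: bmfun_chi.
  (* Multiplying [chi xi] by the j-th power of e(<u,x>) shifts its frequency by j u, so [decay] is
     exactly the moment bound. *)
  apply: le_trans (HS N); rewrite le_eqVlt; apply/orP; left; apply/eqP.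
  apply: eq_bigr => j _; congr (nc _ ^+ 2); congr L; apply/funext => x.
  by rewrite chiD mulrC echarX /chi dotvZl.
have LAE : L (cindic (A `&` E)) = 0.
  have bE : bmfun (cindic E : T -> Cx) by exact/(bmfun_cindicP (R := R)).
  (* Multiplication by the indicator of [A] keeps [cindic E] annihilated; frequency 0 then gives the
     mass of the intersection. *)
  have [_ H] := multiplier_measurable nu c mA.
  rewrite -(H _ bE annE 0); congr L; apply/funext => x.
  by rewrite chi0 mulr1 /cindic indicI rmorphM.
have -> : L (cindic A) = L (cindic (A `\` E)).
  rewrite -[RHS]add0r -LAE -cfunctionalD; last 2 first.
  - by apply/(bmfun_cindicP (R := R)); exact: measurableI.
  - by apply/(bmfun_cindicP (R := R)); exact: measurableD.
  congr L; apply/funext => x; rewrite /cindic -rmorphD; congr (_%:C)%C.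
  rewrite setDE !indicI indicC /= !indicE; case: (x \in E) => /=; ring.
apply: le_trans (nc_cfunctional_cindic c _ AE) _; first exact: measurableD.
have C1 : 0 < C0 + 1 by rewrite ltr_wpDl.
rewrite -/C0 mulrA ler_pdivrMr// [leLHS]mulrC ler_pM2l//.
by rewrite lerDl.
Qed.

Lemma dotvv_ge0 (v : 'rV[R]_n) : 0 <= dotv v v.
Proof. by apply: sumr_ge0 => i _; rewrite -expr2 sqr_ge0. Qed.

Lemma enorm_ge0 (v : 'rV[R]_n) : 0 <= enorm v.
Proof. exact: sqrtr_ge0. Qed.

Lemma sqr_enorm (v : 'rV[R]_n) : enorm v ^+ 2 = \sum_i v 0 i ^+ 2.
Proof. by rewrite sqr_sqrtr ?dotvv_ge0//; apply: eq_bigr => i _; rewrite expr2. Qed.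

Lemma enormZ a (v : 'rV[R]_n) : enorm (a *: v) = `|a| * enorm v.
Proof.
rewrite /enorm -sqrtr_sqr -sqrtrM ?sqr_ge0//; congr Num.sqrt.
by rewrite /dotv mulr_sumr; apply: eq_bigr => i _; rewrite !mxE; ring.
Qed.

Lemma enormN (v : 'rV[R]_n) : enorm (- v) = enorm v.
Proof. by rewrite -scaleN1r enormZ normrN1 mul1r. Qed.

Lemma enorm0 : enorm (0 : 'rV[R]_n) = 0.
Proof. by rewrite -(scale0r (0 : 'rV[R]_n)) enormZ normr0 mul0r. Qed.

Lemma enormD (u v : 'rV[R]_n) : enorm (u + v) <= enorm u + enorm v.
Proof.
rewrite -(@ler_pXn2r _ 2) ?nnegrE ?addr_ge0 ?enorm_ge0//.
rewrite sqrrD !sqr_enorm.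
have -> : \sum_i (u + v) 0 i ^+ 2 =
   \sum_i u 0 i ^+ 2 + 2 * (\sum_i u 0 i * v 0 i) + \sum_i v 0 i ^+ 2.
  by rewrite mulr_sumr -!big_split; apply: eq_bigr => i _ /=; rewrite mxE; ring.
rewrite lerD2r lerD2l -[leRHS]mulr_natl ler_wpM2l//.
apply: le_trans (ler_norm _) _.
rewrite -(@ler_pXn2r _ 2) ?nnegrE ?mulr_ge0 ?enorm_ge0//.
by rewrite real_normK ?num_real// exprMn !sqr_enorm cauchy_schwarz_sum.
Qed.

(** The difference is xi + (s - |v|) u divided by |v|. The numerator has norm at most 2 |xi| because
    |v| differs from s by at most |xi|, and |v| >= s/2. *)
Lemma direction_deviation (xi u : 'rV[R]_n) (s : R) : enorm u = 1 -> 0 < s ->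
  2 * enorm xi <= s ->
  let v := xi + s *: u in
  0 < enorm v /\ enorm ((enorm v)^-1 *: v - u) <= 4 * enorm xi / s.
Proof.
move=> u1 s0 xs v.
have su : enorm (s *: u) = s by rewrite enormZ u1 mulr1 gtr0_norm.
have x0 := enorm_ge0 xi.
have h1 : enorm v <= enorm xi + s by rewrite -[X in _ + X]su; exact: enormD.
have h2 : s <= enorm v + enorm xi.
  have E : s *: u = v + - xi by rewrite /v addrAC subrr add0r.
  by rewrite -[leLHS]su E; apply: le_trans (enormD _ _) _; rewrite enormN.
have h3 : s / 2 <= enorm v by lra.
have v0 : 0 < enorm v by apply: lt_le_trans h3; rewrite divr_gt0.
split=> //.
have -> : (enorm v)^-1 *: v - u = (enorm v)^-1 *: (xi + (s - enorm v) *: u).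
  move: (enorm v) v0 => r r0; apply/rowP => i; rewrite !mxE; field.
  by rewrite gt_eqF.
rewrite enormZ gtr0_norm ?invr_gt0// mulrC ler_pdivrMr//.
apply: (@le_trans _ _ (2 * enorm xi)).
  apply: le_trans (enormD _ _) _; rewrite enormZ u1 mulr1 mulr_natl mulr2n lerD2l.
  by rewrite ler_norml; apply/andP; split; lra.
rewrite mulrAC ler_pdivlMr//.
have : enorm xi * s <= enorm xi * (2 * enorm v) by rewrite ler_wpM2l//; lra.
nra.
Qed.

End DirectionalDecay.

(** Cauchy condensation. The K-th dyadic block runs from 2^K - 1, the indices being shifted by one,
    and its 2^K terms are at most 2^(-K b) each, which leaves a geometric series of ratio [q]. *)
Lemma p_series_bounded (R : realType) (b : R) : 1 < b ->
  exists Z : R, forall N : nat, \sum_(j < N) (j.+1%:R `^ b)^-1 <= Z.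
Proof.
move=> b1; pose q : R := 2 / 2 `^ b.
have p0 : 0 < 2 `^ b :> R by rewrite powR_gt0.
have q0 : 0 < q by rewrite divr_gt0.
have q1 : q < 1.
  rewrite ltr_pdivrMr// mul1r -[X in X < _](powRr1 (ler0n R 2)).
  rewrite /powR !pnatr_eq0 /= ltr_expR ltr_pM2r// ln_gt0// ltr1n//.
exists (1 - q)^-1 => N.
have f0 j : 0 <= (j.+1%:R `^ b)^-1 :> R by rewrite invr_ge0 powR_ge0.
have H K : \sum_(0 <= j < 2 ^ K - 1) (j.+1%:R `^ b)^-1 <= \sum_(k < K) q ^+ k.
  elim: K => [|K IH]; first by rewrite big_geq// big_ord0.
  have h2 : (2 ^ K - 1 <= 2 ^ K.+1 - 1)%N by rewrite leq_sub2r// leq_exp2l.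
  rewrite (big_cat_nat _ h2)//= big_ord_recr /=; apply: lerD => //.
  apply: (@le_trans _ _ (\sum_(2 ^ K - 1 <= j < 2 ^ K.+1 - 1) ((2 ^+ K) `^ b)^-1)).
    rewrite big_nat_cond [leRHS]big_nat_cond; apply: ler_sum => j /andP[/andP[j1 _] _].
    rewrite lef_pV2 ?posrE ?powR_gt0 ?ltr0n ?exprn_gt0//.
    apply: ge0_ler_powR; rewrite ?nnegrE ?exprn_ge0//; first by rewrite ltW// (lt_trans ltr01).
    rewrite -natrX ler_nat; move: j1; rewrite leq_subLR add1n; exact.
  rewrite sumr_const_nat.
  have -> : (2 ^ K.+1 - 1 - (2 ^ K - 1) = 2 ^ K)%N.
    by rewrite expnS mul2n -addnn -addnBA ?expn_gt0// addnK.
  have -> : (2 ^+ K) `^ b = (2 `^ b) ^+ K :> R.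
    elim: K {IH h2} => [|K IHK]; first by rewrite !expr0 powR1.
    by rewrite !exprS powRM ?exprn_ge0// IHK.
  by rewrite -[leLHS]mulr_natr natrX mulrC /q expr_div_n.
apply: (@le_trans _ _ (\sum_(0 <= j < 2 ^ N - 1) (j.+1%:R `^ b)^-1)).
  have h2 : (N <= 2 ^ N - 1)%N by rewrite leq_subRL ?expn_gt0// add1n ltn_expl.
  rewrite (big_cat_nat _ h2)//= big_mkord lerDl sumr_ge0//.
apply: le_trans (H N) _.
have q10 : 0 < 1 - q by rewrite subr_gt0.
rewrite -[leRHS]mul1r ler_pdivlMr// mulrC.
have -> : (1 - q) * (\sum_(k < N) q ^+ k) = 1 - q ^+ N.
  by rewrite -opprB mulNr -subrX1 opprB.
by rewrite lerBlDr lerDl exprn_ge0// ltW.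
Qed.

(** * Orthogonal projections onto row spaces *)

Section OrthogonalProjection.
Variables (R : realType).
Local Notation Cx := (C R).
Local Notation nc := (@ComplexField.Normc.normc R).

Lemma adjmxM p q r (A : 'M[Cx]_(p, q)) (B : 'M[Cx]_(q, r)) :
  adjmx (A *m B) = adjmx B *m adjmx A.
Proof. by rewrite /adjmx map_mxM trmx_mul. Qed.

Lemma mulmx_adj_eq0 q (y : 'rV[Cx]_q) : y *m adjmx y = 0 -> y = 0.
Proof.
move=> /matrixP/(_ 0 0); rewrite !mxE => h.
have : \sum_(j < q) nc (y 0 j) ^+ 2 = 0.
  apply: complexI; rewrite rmorph_sum /= -[RHS]h.
  by apply: eq_bigr => j _; rewrite !mxE -mulc_conjc.
move=> /psumr_eq0P H; apply/rowP => j; rewrite mxE; apply: nc0_eq0.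
by apply/eqP; rewrite -sqrf_eq0 H// => i _; exact: sqr_ge0.
Qed.

(** Positive definiteness: a vector v in the kernel makes v B orthogonal to itself. Thus [invmx] in
    [proj] is a true inverse and not its default value. *)
Lemma gram_unitmx p q (B : 'M[Cx]_(p, q)) : row_free B -> B *m adjmx B \in unitmx.
Proof.
move=> fB; rewrite -row_free_unit; apply: inj_row_free => v vB.
apply/eqP; rewrite -(mulmx_free_eq0 _ fB); apply/eqP; apply: mulmx_adj_eq0.
by rewrite adjmxM mulmxA -(mulmxA v) vB mul0mx.
Qed.

Lemma mulmx_proj m (S : 'M[Cx]_m) (y : 'rV[Cx]_m) : (y <= S)%MS -> y *m Defs.proj S = y.
Proof.
rewrite -(eq_row_base S) => /submxP[z ->]; rewrite /Defs.proj /=.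
move: (row_base S) (row_base_free S) => B fB.
by rewrite -!mulmxA (mulmxA B) (mulmxA (B *m _)) mulmxV ?mul1mx// gram_unitmx.
Qed.

Lemma proj_fixed_sub m (S : 'M[Cx]_m) (y : 'rV[Cx]_m) :
  y *m (1%:M - Defs.proj S) = 0 -> (y <= S)%MS.
Proof.
rewrite mulmxBr mulmx1 => /eqP; rewrite subr_eq0 => /eqP ->.
by rewrite -(eq_row_base S) /Defs.proj mulmxA submxMl.
Qed.

Lemma nc_le_frob m (D : 'M[Cx]_m) i j : nc (D i j) <= frob D.
Proof.
rewrite -(@ler_pXn2r _ 2) ?nnegrE ?nc_ge0 ?sqrtr_ge0// sqr_nc sqr_sqrtr; last first.
  by do 2 (apply: sumr_ge0 => ? _); rewrite addr_ge0 ?sqr_ge0.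
rewrite (bigD1 i)//= (bigD1 j)//= -addrA lerDl addr_ge0// ?sumr_ge0// => [k _|k _].
  by rewrite addr_ge0 ?sqr_ge0.
by apply: sumr_ge0 => l _; rewrite addr_ge0 ?sqr_ge0.
Qed.

End OrthogonalProjection.

(** * Linear combinations of the coordinates of the vector measure, as functionals *)

Section MeasureColumns.
Variables (R : realType) (n m : nat) (mu : cmeasure R n m).
Local Notation Cx := (C R).
Local Notation nc := (@ComplexField.Normc.normc R).
Local Notation T := (Rn R n).

Lemma cRB (a b : R) : cR (a - b) = cR a - cR b.
Proof. by apply/eqP; rewrite eq_complex /= subrr !eqxx. Qed.

Definition jordan_index : finType := ('I_m * (bool * bool))%type.

Definition jordan_measure (i : jordan_index) : {finite_measure set T -> \bar R} :=
  match i.2 with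
  | (false, false) => re_pos mu i.1
  | (false, true) => re_neg mu i.1
  | (true, false) => im_pos mu i.1
  | (true, true) => im_neg mu i.1
  end.

(** With the factors 1, -1, i, -i the functional integrates against the scalar measure sum of q_j
    mu_j, the product of the row mu with the column q. *)
Definition jordan_coef (q : 'I_m -> R[i]) (i : jordan_index) : R[i] :=
  (if i.2.1 then iC R else 1) * (if i.2.2 then -1 else 1) * q i.1.

Lemma jordan_functionalE (q : 'I_m -> R[i]) (F : T -> R[i]) :
  cfunctional jordan_measure (jordan_coef q) F =
  \sum_j ((crint (re_pos mu j) F - crint (re_neg mu j) F) +
          iC R * (crint (im_pos mu j) F - crint (im_neg mu j) F)) * q j.
Proof.
rewrite /cfunctional.
rewrite -(pair_bigA _ (fun j b => jordan_coef q (j, b) * crint (jordan_measure (j, b)) F)) /=.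
apply: eq_bigr => j _.
transitivity (\sum_(b1 : bool) \sum_(b2 : bool)
    jordan_coef q (j, (b1, b2)) * crint (jordan_measure (j, (b1, b2))) F).
  by rewrite pair_bigA; apply: eq_bigr => -[].
rewrite !big_bool /jordan_coef /jordan_measure /=; ring.
Qed.

Lemma cmeas_val_functional (q : 'I_m -> R[i]) (A : set T) : measurable A ->
  cfunctional jordan_measure (jordan_coef q) (cindic A) =
  \sum_j cmeas_val mu A 0 j * q j.
Proof.
move=> mA; rewrite jordan_functionalE; apply: eq_bigr => j _; congr (_ * _).
by rewrite !crint_cindic// mxE !cRB.
Qed.

Lemma crint_chi (nu : {finite_measure set T -> \bar R}) (xi : 'rV[R]_n) :
  crint nu (chi xi) = cR (rint nu (fun x : T => cos (2 * pi * dotv xi x))) -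
    @iC R * cR (rint nu (fun x : T => sin (2 * pi * dotv xi x))).
Proof.
have m2 : measurable_fun setT (fun x : T => 2 * pi * dotv xi x).
  by apply: measurable_funM => //; exact: measurable_dotv.
have isin : nu.-integrable setT (EFin \o (fun x : T => sin (2 * pi * dotv xi x))).
  apply: (@bounded_integrable _ _ _ _ _ 1) => [|x]; last exact: sin_max.
  by apply: (measurableT_comp _ m2); apply: continuous_measurable_fun; exact: continuous_sin.
apply/eqP; rewrite eq_complex /crint /cR /iC /chi /echar /=; apply/andP; split; apply/eqP.
  by rewrite !(mul0r, mul1r, mulr0, subr0, oppr0, addr0, subrr).
under eq_Rintegral do rewrite -mulN1r.
by rewrite RintegralZl// mulN1r !(mul0r, mul1r, add0r, mulr0, addr0).
Qed.

Lemma fourier_functional (q : 'I_m -> R[i]) (xi : 'rV[R]_n) :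
  cfunctional jordan_measure (jordan_coef q) (chi xi) = \sum_j fourier mu xi 0 j * q j.
Proof.
rewrite jordan_functionalE; apply: eq_bigr => j _; congr (_ * _).
by rewrite !crint_chi mxE /cint !cRB; ring.
Qed.

Lemma nc_crint_chi (nu : {finite_measure set T -> \bar R}) (xi : 'rV[R]_n) :
  nc (crint nu (chi xi)) <= 2 * fine (nu setT).
Proof.
have [ire iim] := bmfun_integrable nu (bmfun_chi xi).
have H (f : T -> R) : nu.-integrable setT (EFin \o f) -> (forall x, `|f x| <= 1) ->
    `|\int[nu]_x f x| <= fine (nu setT).
  move=> fi f1; apply: le_trans (le_normr_Rintegral measurableT fi) _.
  rewrite -[leRHS]mul1r -Rintegral_cst//; apply: le_Rintegral => //.
    exact: integrable_norm fi.
  apply: (@bounded_integrable _ _ _ _ (fun=> 1) 1) => // x; by rewrite normr1.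
apply: le_trans (nc_le_ReIm _) _; rewrite mulr_natl mulr2n; apply: lerD; apply: H => // x.
  by rewrite -(nc_echar (dotv xi x)); exact: Re_le_nc.
by rewrite -(nc_echar (dotv xi x)); exact: Im_le_nc.
Qed.

Lemma fourier_bounded : exists B : R, forall xi j, nc (fourier mu xi 0 j) <= B.
Proof.
exists (\sum_i 2 * fine (jordan_measure i setT)) => xi j.
have -> : fourier mu xi 0 j = cfunctional jordan_measure (jordan_coef (fun l => (l == j)%:R)) (chi xi).
  rewrite fourier_functional (bigD1 j)//= eqxx mulr1 big1 ?addr0// => l lj.
  by rewrite (negPf lj) mulr0.
apply: le_trans (nc_sum _ _ _) _; apply: ler_sum => i _.
rewrite ncM -[leRHS]mul1r ler_pM ?nc_ge0 ?nc_crint_chi// /jordan_coef !ncM.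
have h1 : nc (if i.2.1 then iC R else 1) = 1.
  by case: i.2.1; rewrite ?nc1//= expr0n expr1n add0r sqrtr1.
have h2 : nc (if i.2.2 then -1 else 1) = 1 by case: i.2.2; rewrite ?ncN nc1.
rewrite h1 h2 !mul1r; by case: (_ == _); rewrite ?nc1 ?nc0.
Qed.

End MeasureColumns.

(** * Decay of the Fourier transform transversally to phi(u) *)

Section BundleDecay.
Variables (R : realType) (n m k : nat).
Variables (phi : 'rV[R]_n -> 'M[C R]_m) (alpha : R) (mu : cmeasure R n m).
Local Notation nc := (@ComplexField.Normc.normc R).
Hypotheses (Hphi : homogeneous_bundle k phi) (a12 : 1 / 2 < alpha).
Hypotheses (Hh : holder_on_sphere phi alpha) (Hmu : in_Mphi phi mu).
Variables (u : 'rV[R]_n) (l : 'I_m).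
Hypothesis u1 : enorm u = 1.

(** The l-th column of Q, so that [L] integrates against the l-th coordinate of mu Q. *)
Definition normal_coef (j : 'I_m) : R[i] := (1%:M - Defs.proj (phi u)) j l.
Local Notation L := (cfunctional (jordan_measure mu) (jordan_coef normal_coef)).

(** By homogeneity the transform y at v lies in phi(w) for w = v/|v|, hence y (1 - P(u)) = y (P(w) -
    P(u)). The first factor is bounded and the Holder condition controls the second. *)
Lemma normal_fourier_decay (xi : 'rV[R]_n) : exists K : R, forall s : R,
  0 < s -> 2 * enorm xi <= s -> nc (L (chi (xi + s *: u))) <= K / s `^ alpha.
Proof.
have [B HB] := fourier_bounded mu; have [c Hc] := Hh.
exists (\sum_(j < m) B * (`|c| * (4 * enorm xi) `^ alpha)) => s s0 xs.
have [v0 dev] := direction_deviation u1 s0 xs.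
set v := xi + s *: u in v0 dev *; set w := (enorm v)^-1 *: v in dev.
have v_neq0 : v != 0 by apply: contraTneq v0 => ->; rewrite enorm0 ltxx.
have w1 : enorm w = 1 by rewrite enormZ gtr0_norm ?invr_gt0// mulVf// gt_eqF.
have yw : (fourier mu v <= phi w)%MS.
  have [_ [_ /(_ v (enorm v)^-1 v_neq0)]] := Hphi.
  rewrite invr_gt0 => /(_ v0) /eqmxP ->; exact: Hmu.
have -> : L (chi v) = \sum_j fourier mu v 0 j * (Defs.proj (phi w) - Defs.proj (phi u)) j l.
  rewrite fourier_functional.
  have /matrixP/(_ 0 l) : fourier mu v *m (1%:M - Defs.proj (phi u)) =
      fourier mu v *m (Defs.proj (phi w) - Defs.proj (phi u)).
    by rewrite !mulmxBr mulmx1 (mulmx_proj yw).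
  by rewrite !mxE => ->.
apply: le_trans (nc_sum _ _ _) _; rewrite mulr_suml; apply: ler_sum => j _.
rewrite ncM -mulrA; apply: ler_pM; rewrite ?nc_ge0//.
apply: le_trans (nc_le_frob _ _ _) _; apply: le_trans (Hc w u w1 u1) _.
have a0 : 0 <= alpha by apply: ltW; apply: lt_trans a12; rewrite divr_gt0.
(* The sign of [c] is not prescribed, so its absolute value takes over before the other factor is
   enlarged. *)
apply: le_trans (ler_wpM2r (powR_ge0 _ _) (ler_norm c)) _.
rewrite -mulrA ler_wpM2l//.
have sV : (s^-1) `^ alpha = (s `^ alpha)^-1.
  have sa : s `^ alpha != 0 by rewrite gt_eqF// powR_gt0.
  apply: (mulIf sa); rewrite mulVf// -powRM ?invr_ge0 ?(ltW s0)//.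
  by rewrite mulVf ?gt_eqF// powR1.
rewrite -sV -powRM ?mulr_ge0 ?enorm_ge0 ?invr_ge0 ?(ltW s0)//.
by apply: ge0_ler_powR; rewrite ?nnegrE ?enorm_ge0// divr_ge0 ?mulr_ge0 ?enorm_ge0// ltW.
Qed.

Lemma normal_fourier_square_summable (xi : 'rV[R]_n) : exists S : R, forall N : nat,
  \sum_(j < N) nc (L (chi (xi + j%:R *: u))) ^+ 2 <= S.
Proof.
have [K HK] := normal_fourier_decay xi.
have [|Z HZ] := @p_series_bounded R (2 * alpha).
  by move: a12; rewrite ltr_pdivrMr// mulrC.
(* The decay bound holds for s >= 2 |xi| only, so the terms up to [J] enter the constant as they
   are. Starting at [J.+1] makes s positive and at least j + 1, as the comparison with the p-series
   of exponent 2 alpha requires. *)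
pose J := Num.bound (2 * enorm xi).
have HJ : 2 * enorm xi <= J%:R.
  by apply/ltW/archi_boundP; rewrite mulr_ge0 ?enorm_ge0.
pose f (j : nat) := nc (L (chi (xi + j%:R *: u))) ^+ 2.
exists (\sum_(j < J.+1) f j + K ^+ 2 * Z) => N.
have f0 j : 0 <= f j by exact: sqr_ge0.
apply: (@le_trans _ _ (\sum_(j < J.+1 + N) f j)).
  by rewrite addnC big_split_ord /= lerDl sumr_ge0.
rewrite big_split_ord /= lerD2l.
apply: (@le_trans _ _ (K ^+ 2 * \sum_(j < N) (j.+1%:R `^ (2 * alpha))^-1)); last first.
  by rewrite ler_wpM2l ?sqr_ge0.
rewrite mulr_sumr; apply: ler_sum => j _.
pose s : R := (J.+1 + j)%:R.
have s0 : 0 < s by rewrite ltr0n.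
have xs : 2 * enorm xi <= s.
  by apply: le_trans HJ _; rewrite ler_nat addSn leqW// leq_addr.
have h := HK s s0 xs.
apply: (@le_trans _ _ ((K / s `^ alpha) ^+ 2)).
  by rewrite lerXn2r ?nnegrE ?nc_ge0// (le_trans _ h)// nc_ge0.
rewrite exprMn exprVn ler_wpM2l ?sqr_ge0// lef_pV2 ?posrE ?powR_gt0 ?exprn_gt0 ?powR_gt0//.
have -> : (s `^ alpha) ^+ 2 = s `^ (2 * alpha).
  by rewrite mulrC powRrM powR_mulrn// powR_ge0.
apply: ge0_ler_powR; rewrite ?nnegrE ?ler_nat//.
  by move: a12; rewrite ltr_pdivrMr// mulrC; lra.
by rewrite addSn ltnS leq_addl.
Qed.

End BundleDecay.

Unset Implicit Arguments.

Theorem mainTheorem13 (R : realType) (n m k : nat)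
  (phi : 'rV[R]_n -> 'M[C R]_m) (alpha : R)
  (mu : cmeasure R n m) (A : set (Rn R n)) :
  homogeneous_bundle k phi ->
  1 / 2 < alpha -> holder_on_sphere phi alpha ->
  in_Mphi phi mu ->
  measurable A ->
  Nset A `<=` [set u | enorm u = 1 /\ (cmeas_val mu A <= phi u)%MS].
Proof.
move=> Hphi a12 Hh Hmu mA u [u1 nA]; split => //.
apply: proj_fixed_sub; apply/rowP => l; rewrite !mxE.
(* The l-th coordinate of mu(A) Q is the functional of column l of Q at the indicator of [A]. *)
rewrite -[LHS](cmeas_val_functional mu (normal_coef phi u l) mA).
apply: cfunctional_null_projection nA => // xi.
exact: (normal_fourier_square_summable Hphi a12 Hh Hmu l u1 xi).
Qed.
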